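(* The smallest element of $\mathcal{B}_{1,\aleph_0}$ strictly greater than $\frac{1+\sqrt{5}}{2}$ is $q_3$; that is, $q_3\in\mathcal{B}_{1,\aleph_0}$ and $\mathcal{B}_{1,\aleph_0}\cap\left(\frac{1+\sqrt5}{2},q_3\right)=\emptyset$.
   Context: For $q\in(1,2)$ let $I_q=[0,\frac{1}{q-1}]$. A $q$-expansion of $x\in I_q$ is a sequence $(\delta_i)_{i=1}^\infty\in\{0,1\}^{\mathbb{N}}$ with $x=\sum_{i=1}^\infty \delta_i q^{-i}$, and $\Sigma_q(x)$ denotes the set of all $q$-expansions of $x$. Define $\mathcal{B}_{1,\aleph_0}=\{q\in[\frac{1+\sqrt5}{2},2): \#\Sigma_q(1)=\aleph_0\}$, where $\#$ denotes cardinality and $\aleph_0$ means countably infinite. The number $q_3\approx 1.68042$ is the unique root of $x^5-x^4-x^3-x+1=0$ in $(1,2)$. *)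

(* Defs.v *)
From HB Require Import structures.
From mathcomp Require Import all_boot all_order all_algebra.
From mathcomp Require Import all_classical all_reals all_analysis.

Set Implicit Arguments.
Unset Strict Implicit.
Unset Printing Implicit Defensive.

Import Order.TTheory GRing.Theory Num.Theory.
Import numFieldNormedType.Exports.

Local Open Scope classical_set_scope.
Local Open Scope ring_scope.

(* Digits are booleans read as 0 and 1; they are numbered from 0, so [d i] is
   the coefficient of q^-(i+1). *)
Definition qexpansions (R : realType) (q x : R) : set (nat -> bool) :=
  [set d : nat -> bool |
    series (fun i => (d i)%:R * q ^- i.+1 : R) @ \oo --> x].

Definition golden_ratio (R : realType) : R := (1 + Num.sqrt 5%:R) / 2%:R.

(* For q in ]1, 2[ the point 1 lies in [0, 1/(q-1)], so no membership condition
   is needed on it. *)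
Definition B1_aleph0 (R : realType) : set R :=
  [set q | golden_ratio R <= q < 2 /\ (qexpansions q 1 #= [set: nat])%card].
Arguments B1_aleph0 : clear implicits.

Definition q3_root (R : realType) (x : R) : Prop :=
  1 < x < 2 /\ x ^+ 5 - x ^+ 4 - x ^+ 3 - x + 1 = 0.

(* Main.v *)
(* Reading an expansion digit by digit moves [x] by [y |-> q y - b] inside
   I = [0, 1/(q-1)]; [x] has several expansions iff its orbit meets a fork, where both
   digits stay in I. If every point with several expansions led to a fork both of whose
   children have several expansions, a diagonal argument would make the set of
   expansions uncountable. So if 1 has countably infinitely many expansions, its tree
   contains a "thin" point: one with several expansions, below which each fork has a
   child with a unique expansion. For q between the golden ratio and q3 the points with
   a unique expansion are 0 and the q^-n/(q^2-1), n >= -1, up to the reflection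
   x |-> 1/(q-1) - x, and no fork has two such children. Hence from a thin point one
   can pass from fork to fork forever, and each passage relates two weights w in
   {0} u {q^-n, n >= 1}. Solving these relations shows that an endless
   passage exists only if q is a root of
   x^6-x^4-x^3-2x^2-x-1 or of x^6-2x^4-x^3-1. Both are irreducible modulo 2 and take
   values other than 1, -1 at x = 1; as the tree of 1 lies in Z[q], reaching a weight
   q^-n there would make q^2-1 divide a unit of Z[q], which is impossible.
   At q = q3 one has q^3(q^2-q-1) = q-1, so the orbit of 1 along 1(1000)^oo is
   periodic, and the only way to leave it is at q-1 towards q^2-q, which has a unique
   expansion. *)

Require Import Defs.
From HB Require Import structures.
From mathcomp Require Import all_boot all_order all_algebra.
From mathcomp Require Import all_classical all_reals all_analysis.
From mathcomp Require Import zify ring lra.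

Set Implicit Arguments.
Unset Strict Implicit.
Unset Printing Implicit Defensive.

Import Order.TTheory GRing.Theory Num.Theory.
Import numFieldNormedType.Exports.

Local Open Scope classical_set_scope.
Local Open Scope ring_scope.

(** * Digit orbits, forks and expansions *)

Section Orbits.
Variables (R : realType) (q : R).
Implicit Types (x y : R) (w : seq bool) (d : nat -> bool).

Let p : R := (q - 1)^-1.

Definition orbit x w : R := foldl (fun y (b : bool) => q * y - b%:R) x w.

Definition in_base x : bool := 0 <= x <= (q - 1)^-1.

(** For [q > 1] this means that the series converges to [x]; see [qexpansionsE]. *)
Definition expansion x d : Prop := forall n, in_base (orbit x (mkseq d n)).

(* Under [q > 1] an orbit never returns to the interval once it has left it, so
   this says that [x] has two different expansions. *)
Definition branching x : Prop :=
  exists w, forall b, in_base (orbit x (rcons w b)).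

Definition thin x : Prop :=
  branching x /\ forall w, ~ forall b, branching (orbit x (rcons w b)).

Lemma orbit_cat x w1 w2 : orbit x (w1 ++ w2) = orbit (orbit x w1) w2.
Proof. by rewrite /orbit foldl_cat. Qed.

Lemma orbit_rcons x w b : orbit x (rcons w b) = q * orbit x w - b%:R.
Proof. by rewrite /orbit foldl_rcons. Qed.

Lemma orbit_nseq_false x n : orbit x (nseq n false) = q ^+ n * x.
Proof.
elim: n x => [|n IHn] x /=; first by rewrite mul1r.
by rewrite IHn subr0 exprSr mulrA.
Qed.

Lemma orbit_mkseq_sum x d n : q != 0 ->
  orbit x (mkseq d n) = q ^+ n * (x - \sum_(0 <= i < n) (d i)%:R * q ^- i.+1).
Proof.
move=> q0; elim: n => [|n IHn].
  by rewrite /mkseq /= big_nil subr0 mul1r.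
rewrite mkseqS orbit_rcons IHn big_nat_recr //= exprS.
have qn0 : q ^+ n != 0 by rewrite expf_neq0.
by field; rewrite q0 qn0.
Qed.

Hypothesis q1 : 1 < q.

Let qB1_gt0 : 0 < q - 1. Proof. by rewrite subr_gt0. Qed.
Let p_gt0 : 0 < p. Proof. by rewrite invr_gt0. Qed.
Let q_gt0 : 0 < q. Proof. exact: lt_trans ltr01 q1. Qed.
Let q_neq0 : q != 0. Proof. by rewrite gt_eqF. Qed.

Lemma base_fixpoint : q * p - 1 = p.
Proof. by rewrite /p; field; rewrite gt_eqF. Qed.

(** The digit maps expand and fix the ends 0 and [1/(q-1)] respectively, so points outside only move
    further out. *)
Lemma in_base_pred x (b : bool) : in_base (q * x - b%:R) -> in_base x.
Proof.
rewrite /in_base -/p => /andP[h0 hp]; apply/andP; split.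
  rewrite -(pmulr_rge0 _ q_gt0); apply: le_trans h0 _.
  by rewrite lerBlDr lerDl ler0n.
rewrite -(ler_pM2l q_gt0) -(subrK 1 (q * p)) base_fixpoint.
by rewrite -lerBlDr (le_trans _ hp) // lerB // lern1 leq_b1.
Qed.

Lemma in_base_orbit x w : in_base (orbit x w) -> in_base x.
Proof.
by elim: w x => //= b w IHw x /IHw /in_base_pred.
Qed.

Lemma in_base_prefix x w1 w2 : in_base (orbit x (w1 ++ w2)) -> in_base (orbit x w1).
Proof. by rewrite orbit_cat => /in_base_orbit. Qed.

Lemma in_base_orbit_take x w n :
  in_base (orbit x w) -> in_base (orbit x (take n w)).
Proof. by rewrite -{1}(cat_take_drop n w) => /in_base_prefix. Qed.

Lemma in_base_reflect x : in_base (p - x) = in_base x.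
Proof.
rewrite /in_base -/p subr_ge0 andbC; congr (_ && _).
by rewrite lerBlDr lerDl.
Qed.

Lemma orbit_reflect x w : orbit (p - x) (map negb w) = p - orbit x w.
Proof.
elim: w x => //= b w IHw x; rewrite -IHw; congr orbit.
by rewrite -{2}base_fixpoint; case: b => /=; ring.
Qed.

Lemma branching_orbit x w : branching (orbit x w) -> branching x.
Proof.
move=> [w' hw']; exists (w ++ w') => b.
by rewrite rcons_cat orbit_cat.
Qed.

Lemma branching_in_base x : branching x -> in_base x.
Proof. by move=> [w /(_ true)]; apply: in_base_orbit. Qed.

Let rcons_map_negb w b : rcons (map negb w) b = map negb (rcons w (~~ b)).
Proof. by rewrite map_rcons negbK. Qed.

Lemma branching_reflect x : branching x -> branching (p - x).
Proof.
move=> [w hw]; exists (map negb w) => b.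
by rewrite rcons_map_negb orbit_reflect in_base_reflect.
Qed.

Lemma thin_orbit x w : thin x -> branching (orbit x w) -> thin (orbit x w).
Proof.
move=> [_ hx] hw; split=> // w' h; apply: (hx (w ++ w')) => b.
by rewrite rcons_cat orbit_cat.
Qed.

Lemma thin_reflect x : thin x -> thin (p - x).
Proof.
move=> [bx hx]; split; first exact: branching_reflect.
move=> w h; apply: (hx (map negb w)) => b.
have /branching_reflect := h (~~ b).
by rewrite -orbit_reflect map_rcons negbK subKr.
Qed.

Lemma two_expansions_branching x d d' :
  expansion x d -> expansion x d' -> d <> d' -> branching x.
Proof.
move=> hd hd' ndd'.
have [n0 hn0] : exists n, d n != d' n.
  apply: contrapT => h; apply: ndd'; apply/funext => n.
  by apply: contrapT => /eqP hn; apply: h; exists n.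
have [n hn hmin] := ex_minnP (ex_intro (fun n => d n != d' n) n0 hn0).
have eqdd' : mkseq d n = mkseq d' n.
  apply/eq_in_map => i; rewrite mem_iota add0n => /andP[_ ltin].
  by apply/eqP; apply: contraTT ltin => /hmin; rewrite -leqNgt.
exists (mkseq d n) => b.
have := hd n.+1; have := hd' n.+1; rewrite !mkseqS -eqdd'.
by case: b (d n) (d' n) hn => [] [] [].
Qed.

Lemma expansion_glue x w d :
  expansion (orbit x w) d ->
  expansion x (fun i => if (i < size w)%N then nth false w i else d (i - size w)%N).
Proof.
move=> hd n; set e := fun i => _.
have em k : mkseq e (size w + k) = w ++ mkseq d k.
  apply: (@eq_from_nth _ false); first by rewrite size_cat !size_mkseq.
  move=> i; rewrite size_mkseq => hi; rewrite nth_mkseq // nth_cat /e.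
  by case: ltnP => // hwi; rewrite nth_mkseq // ltn_subLR.
have [k [hk ->]] : exists k, (n <= size w + k)%N /\
    mkseq e n = take n (mkseq e (size w + k)).
  exists n; split; first exact: leq_addl.
  by rewrite /mkseq -map_take take_iota (minn_idPl _) ?leq_addl.
by apply: in_base_orbit_take; rewrite em orbit_cat; apply: hd.
Qed.

(* An expansion is determined by the place where it leaves [d0]. *)
Lemma spine_countable x d0 :
  (forall n, ~ branching (orbit x (rcons (mkseq d0 n) (~~ d0 n)))) ->
  countable [set d | expansion x d].
Proof.
move=> off.
pose E n := [set d | expansion x d /\
  (forall i, (i < n)%N -> d i = d0 i) /\ d n = ~~ d0 n].
have sub : [set d | expansion x d] `<=` [set d0] `|` \bigcup_n E n.
  move=> d /= hd; have [->|ne] := pselect (d = d0); first by left.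
  have [n0 hn0] : exists n, d n != d0 n.
    apply: contrapT => h; apply: ne; apply/funext => n.
    by apply: contrapT => /eqP hn; apply: h; exists n.
  have [n hn hmin] := ex_minnP (ex_intro (fun n => d n != d0 n) n0 hn0).
  right; exists n => //; split=> //; split; last by case: (d n) (d0 n) hn => [] [].
  move=> i ltin; apply/eqP; apply: contraTT ltin => /hmin; by rewrite -leqNgt.
apply: (sub_countable (subset_card_le sub)).
rewrite -bigcup2E; apply: bigcup_countable => // -[|[|i]] _ /=.
- exact: finite_set_countable.
- apply: bigcup_countable => // n _; apply: finite_set_countable.
  (* [E n] has at most one element: two would branch after leaving [d0] at place [n], against
     [off]. *)
  apply: sub_finite_set (finite_set1 (xget d0 (E n))) => d hd /=.
  have hx : E n (xget d0 (E n)) by apply: xgetI hd.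
  set d' := xget d0 (E n) in hx *.
  apply: contrapT => ndd'; apply: (off n).
  have drp e : E n e -> expansion (orbit x (rcons (mkseq d0 n) (~~ d0 n)))
                                  (fun i => e (n.+1 + i)%N).
    move=> [he [he1 he2]] k; rewrite -he2.
    have -> : mkseq d0 n = mkseq e n.
      by apply/eq_in_map => i; rewrite mem_iota => /andP[_ /he1].
    rewrite -mkseqS -orbit_cat.
    have -> : mkseq e n.+1 ++ mkseq (fun i => e (n.+1 + i)%N) k = mkseq e (n.+1 + k).
      rewrite /mkseq iotaD map_cat add0n; congr (_ ++ _).
      have -> : iota n.+1 k = map (addn n.+1) (iota 0 k) by rewrite -iotaDl addn0.
      by rewrite -map_comp.
    exact: he.
  apply: two_expansions_branching (drp _ hd) (drp _ hx) _ => eqd.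
  apply: ndd'; apply/funext => i; have [ltin|] := ltnP i n.
    by rewrite (proj1 (proj2 hd)) // (proj1 (proj2 hx)).
  rewrite leq_eqVlt => /predU1P[<-|ltni].
    by rewrite (proj2 (proj2 hd)) (proj2 (proj2 hx)).
  by have := congr1 (fun f => f (i - n.+1)%N) eqd; rewrite /= subnKC.
- exact: countable0.
Qed.

(** A word leading to a fork must follow [d0], and then one of the two digits at its end departs
    from [d0]. *)
Lemma not_branching_spine x d0 :
  (forall n, ~~ in_base (orbit x (rcons (mkseq d0 n) (~~ d0 n)))) -> ~ branching x.
Proof.
move=> off [w hw].
have ew : w = mkseq d0 (size w).
  have pre n : (n <= size w)%N -> take n w = mkseq d0 n.
    elim: n => [|n IHn] ltnw; first by rewrite take0.
    rewrite mkseqS (take_nth false) // IHn ?(ltnW ltnw) //.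
    apply: congr1; apply/eqP; apply: contraT => ne.
    have /negP := off n; case.
    have -> : ~~ d0 n = nth false w n by case: (d0 n) (nth _ _ _) ne => [] [].
    rewrite -IHn ?(ltnW ltnw) // -take_nth //.
    have /in_base_orbit_take := hw true => /(_ n.+1).
    by rewrite -cats1 takel_cat.
  by rewrite -pre // take_size.
by have /negP := off (size w); rewrite -ew; apply; apply: hw.
Qed.

End Orbits.

(** * Thin points from countability; expansions as convergent series *)

Section Expansions.
Variables (R : realType) (q : R).
Hypothesis q1 : 1 < q.

Let p : R := (q - 1)^-1.
Let q_gt0 : 0 < q. Proof. exact: lt_trans ltr01 q1. Qed.
Let q_neq0 : q != 0. Proof. by rewrite gt_eqF. Qed.

Lemma countable_thin x (e : nat -> nat -> bool) :
  branching q x -> (forall d, expansion q x d -> exists n, e n = d) ->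
  exists v, thin q (orbit q x v).
Proof.
move=> bx he; apply: contrapT => nothin.
have /choice[next hnext] : forall v, exists w, branching q (orbit q x v) ->
    forall b, branching q (orbit q x (rcons (v ++ w) b)).
  move=> v; have [bv|nbv] := pselect (branching q (orbit q x v)); last by exists [::].
  apply: contrapT => h; apply: nothin; exists v; split=> // w hw; apply: h.
  by exists w => _ b; rewrite rcons_cat orbit_cat.
(* Stage [n] walks to a place where both children branch and takes the digit that [e n] does not
   have there. *)
pose ext v n := rcons (v ++ next v) (~~ e n (size (v ++ next v))).
pose W := fix W n := if n is n'.+1 then ext (W n') n' else [::].
have bW n : branching q (orbit q x (W n)).
  by elim: n => [|n IHn] //=; apply: hnext.
have szW n : (n <= size (W n))%N.
  elim: n => //= n IHn; rewrite size_rcons ltnS size_cat.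
  exact: leq_trans IHn (leq_addr _ _).
have preW n k : exists s, W (n + k)%N = W n ++ s.
  elim: k => [|k [s hs]]; first by exists [::]; rewrite addn0 cats0.
  rewrite addnS /= /ext hs -!catA rcons_cat; by eexists.
(* The words [W n] extend one another and [W k.+1] has more than [k] digits, so the default [false]
   is never read. *)
pose d k := nth false (W k.+1) k.
have dW n k : (k < size (W n))%N -> d k = nth false (W n) k.
  move=> hk; have [s hs] := preW n (k.+1 - n)%N.
  have [s' hs'] := preW k.+1 (n - k.+1)%N.
  have := hs; rewrite /d; have [lekn|ltnk] := leqP k.+1 n.
    by move: hs'; rewrite subnKC // => -> _; rewrite nth_cat szW.
  by rewrite subnKC ?(ltnW ltnk) // => ->; rewrite nth_cat hk.
have expd : expansion q x d.
  move=> n; have -> : mkseq d n = take n (W n).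
    apply: (@eq_from_nth _ false); rewrite size_mkseq ?size_takel // => i hi.
    by rewrite nth_mkseq // nth_take // (dW n) // (leq_trans hi).
  exact/(in_base_orbit_take q1)/(branching_in_base q1).
have [n en] := he _ expd.
have : d (size (W n ++ next (W n))) = ~~ e n (size (W n ++ next (W n))).
  by rewrite (dW n.+1) /= ?size_rcons // nth_rcons ltnn eqxx.
by rewrite en; case: (d _).
Qed.

(** With partial sums [S_n], the orbit after [n] digits is [q^n (x - S_n)], so staying in the
    interval means [S_n <= x <= S_n + p q^-n]. These bounds are monotone and their gap tends to
    0. *)
Lemma qexpansionsE x : qexpansions q x = [set d | expansion q x d].
Proof.
pose S (d : nat -> bool) n := \sum_(0 <= i < n) (d i)%:R * q ^- i.+1 : R.
have qV n : 0 < q ^- n by rewrite invr_gt0 exprn_gt0.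
have p0 : 0 < p by rewrite invr_gt0 subr_gt0.
have tail0 : (fun n => p * q ^- n) @ \oo --> (0 : R).
  rewrite -(mulr0 p); apply: cvgMr.
  have -> : (fun n => q ^- n) = (fun n => q^-1 ^+ n).
    by apply/funext => n; rewrite exprVn.
  apply: cvg_expr; rewrite gtr0_norm ?invr_gt0 // invf_lt1 //.
have baseE d n : in_base q (orbit q x (mkseq d n)) =
    (S d n <= x <= S d n + p * q ^- n).
  rewrite orbit_mkseq_sum // /in_base -/p -/(S d n).
  rewrite pmulr_rge0 ?exprn_gt0 // subr_ge0; congr (_ && _).
  rewrite mulrC -ler_pdivlMr ?exprn_gt0 //.
  by rewrite lerBlDl.
apply/seteqP; split=> d /=.
  move=> cvgS n; rewrite baseE; apply/andP; split.
    have ndS : {homo S d : m n / (m <= n)%N >-> m <= n}.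
      apply/nondecreasing_seqP => m.
      by rewrite /S big_nat_recr //= lerDl mulr_ge0 // ltW.
    have := nondecreasing_cvgn_le ndS _ n.
    rewrite (cvg_lim _ cvgS) //; apply => //; exact: (cvgP x cvgS).
  pose T n := S d n + p * q ^- n.
  have cvgT : T @ \oo --> x.
    by rewrite -(addr0 x); apply: cvgD.
  have niT : {homo T : m n / (m <= n)%N >-> n <= m}.
    apply/nonincreasing_seqP => m.
    rewrite /T /S big_nat_recr //= -addrA lerD2l.
    have -> : p * q ^- m = q ^- m.+1 + p * q ^- m.+1.
      rewrite exprS /p; field; rewrite q_neq0 expf_neq0 //= gt_eqF // subr_gt0 //.
    by rewrite lerD2r ler_piMl ?(ltW (qV _)) // lern1 leq_b1.
  have := nonincreasing_cvgn_ge niT _ n.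
  rewrite (cvg_lim _ cvgT) //; apply => //; exact: (cvgP x cvgT).
move=> hd.
have hd' n : S d n <= x <= S d n + p * q ^- n by rewrite -baseE.
apply: (@squeeze_cvgr _ _ _ _ (fun n => x - p * q ^- n) (fun=> x)).
- near=> n; have /andP[h1 h2] := hd' n.
  by rewrite -/(S d n) lerBlDr h2 h1.
- rewrite -[X in _ --> X]subr0; apply: cvgB => //; exact: cvg_cst.
- exact: cvg_cst.
Unshelve. all: by end_near.
Qed.

End Expansions.

Lemma exprn_gt1_unbounded (R : realType) (q M : R) : 1 < q -> exists n, M < q ^+ n.
Proof.
move=> q1; have qB1 : 0 < q - 1 by rewrite subr_gt0.
have bern n : 1 + n%:R * (q - 1) <= q ^+ n.
  elim: n => [|n IHn]; first by rewrite mul0r addr0.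
  rewrite exprS; apply: le_trans (ler_wpM2l _ IHn); last by rewrite ltW ?(lt_trans ltr01).
  have : 0 <= n%:R * (q - 1) ^+ 2 by rewrite mulr_ge0 ?sqr_ge0.
  by rewrite -natr1; lra.
exists (Num.bound (M / (q - 1))); apply: lt_le_trans (bern _).
have : M / (q - 1) < (Num.bound (M / (q - 1)))%:R.
  exact: unstable.ltr_bound.
by rewrite ltr_pdivrMr //; lra.
Qed.

(** * Gates, weights and the passage from fork to fork *)

Section Gates.
Variables (R : realType) (q : R).

(* [gate w] is the reflection of [1 + w / (q^2 - 1)], the point reached by the
   digit 0 when the digit 1 of the same fork leads to [w / (q^2 - 1)]. *)
Definition gate (w : R) : R := (1 - (q ^+ 2 - q - 1) - w) / (q ^+ 2 - 1).

(* The points [w / (q^2 - 1)] with these [w] are those with the expansions 0^oo and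
   0^n(01)^oo; no other point up to [gate 0] has a unique expansion. *)
Definition gate_weight (w : R) : Prop :=
  w = 0 \/ exists2 n, (0 < n)%N & w * q ^+ n = 1.

(* After some digits 0 the orbit of [gate w] reaches a fork, where the digit 1
   leads to [r / (q^2 - 1)]; by reflection the digit 0 leads to the point symmetric to
   [(1 - (q^2 - q - 1) - r) / (q^2 - 1)]. *)
Definition gate_step (w r : R) : Prop :=
  (exists m, q ^+ m.+1 * gate w - 1 = r / (q ^+ 2 - 1)) /\
  0 <= r <= 1 - (q ^+ 2 - q - 1).

Definition integral_value (x : R) : Prop :=
  exists P : {poly int}, (map_poly intr P).[q] = x.

(** As [1/(q-1)] need not lie in Z[q], the second alternative is what makes this stable under
    reflection. *)
Definition base_integral (x : R) : Prop :=
  integral_value x \/ integral_value ((q - 1)^-1 - x).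

Definition state (w : R) : Prop :=
  [/\ gate_weight w, thin q (gate w) & base_integral (gate w)].

Hypothesis q1 : 1 < q.
Hypothesis golden_lt : 0 < q ^+ 2 - q - 1.
Hypothesis lt_q3 : q ^+ 3 * (q ^+ 2 - q - 1) < q - 1.

Let p : R := (q - 1)^-1.
Let c : R := (q ^+ 2 - 1)^-1.

(** The ratio 55/34 of Fibonacci numbers is just below the golden ratio, and 79/47 is just above
    [q3]. *)
Lemma q_bounds : 55%:R / 34%:R < q < 79%:R / 47%:R.
Proof.
apply/andP; split; first by move: q1 golden_lt => h1 h2; nra.
case: ltP => // hq; exfalso.
have [t t0 et] : exists2 t, 0 <= t & q = 79%:R / 47%:R + t.
  by exists (q - 79%:R / 47%:R); lra.
have := lt_q3; rewrite et.
have := exprn_ge0 2 t0; have := exprn_ge0 3 t0.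
have := exprn_ge0 4 t0; have := exprn_ge0 5 t0.
by lra.
Qed.

Let q_gt0 : 0 < q. Proof. exact: lt_trans ltr01 q1. Qed.
Let q_neq0 : q != 0. Proof. by rewrite gt_eqF. Qed.
Let qB1_gt0 : 0 < q - 1. Proof. by rewrite subr_gt0. Qed.
Let q2B1_gt0 : 0 < q ^+ 2 - 1. Proof. by have /andP[h _] := q_bounds; nra. Qed.
Let p_gt0 : 0 < p. Proof. by rewrite invr_gt0. Qed.
Let c_gt0 : 0 < c. Proof. by rewrite invr_gt0. Qed.
Let pE : p = c * (q + 1).
Proof. by rewrite /p /c; field; rewrite ?gt_eqF. Qed.
Let cE : c * (q ^+ 2 - 1) = 1.
Proof. by rewrite /c mulVf // gt_eqF. Qed.
Lemma unbranched_gap x : 1 <= q * x -> ~ branching q x -> p < q * x.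
Proof.
move=> hx nb; rewrite ltNge; apply/negP => hle; apply: nb; exists [::] => b /=.
rewrite /in_base -/p; move: hx hle; set z := q * _.
by case: b; rewrite /= => *; apply/andP; split; lra.
Qed.

(** [m.+1] is the least exponent that lifts [y] to 1 or more, and [q * gate 0 < 1] makes [m]
    positive. There the digit 1 is allowed, so the digit 0 must not be. *)
Lemma small_unbranched_orbit y : 0 < y -> y <= gate 0 -> ~ branching q y ->
  exists m, [/\ (0 < m)%N, q ^+ m * y < 1, p < q * (q ^+ m * y)
                & ~ branching q (q ^+ m * y)].
Proof.
move=> y0 yA nb.
have := q_bounds => /andP[hq hq'].
have gate0 : gate 0 = c * (1 - (q ^+ 2 - q - 1)).
  by rewrite /gate subr0 mulrC.
have qA : q * gate 0 < 1.
  rewrite gate0 mulrCA mulrC ltr_pdivrMr // mul1r.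
  by have := mulr_gt0 q_gt0 golden_lt; have := golden_lt; lra.
have [n0 hn0] : exists n, 1 <= q ^+ n * y.
  have [n hn] := exprn_gt1_unbounded y^-1 q1; exists n.
  by rewrite -ler_pdivrMr // div1r ltW.
have [n hn hmin] := ex_minnP (ex_intro (fun n => 1 <= q ^+ n * y) n0 hn0).
have lt1 k : (k < n)%N -> q ^+ k * y < 1.
  by move=> ltkn; rewrite ltNge; apply: contraTN ltkn => /hmin; rewrite -leqNgt.
have qy : q * y < 1 by apply: le_lt_trans qA; rewrite ler_pM2l.
have y1 : y < 1 by nra.
case: n => [|[|m]] in hn hmin lt1 *.
- by move: hn; rewrite mul1r leNgt y1.
- by move: hn; rewrite expr1 leNgt qy.
exists m.+1.
have nbx : ~ branching q (q ^+ m.+1 * y).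
  by rewrite -orbit_nseq_false => /branching_orbit.
split=> //; first exact: lt1.
apply: unbranched_gap => //; by move: hn; rewrite exprS -mulrA.
Qed.

(** The digits 1, 0 return to the window from [p/q] to 1. By [lt_q3] one has [1 <= q x'], so
    [unbranched_gap] gives the lower bound; [1 <= x'] would likewise give [p < x'], against
    [x' < q (q - 1) <= p]. *)
Lemma golden_loop x : x < 1 -> p < q * x -> ~ branching q x ->
  let x' := q * (q * x - 1) in [/\ x' < 1, p < q * x' & ~ branching q x'].
Proof.
move=> x1 px nb x'.
have /andP[hq hq'] := q_bounds.
have nb' : ~ branching q (q * x - 1).
  by move=> h; apply: nb; apply: (@branching_orbit _ _ _ [:: true]).
have nb'' : ~ branching q x'.
  move=> h; apply: nb'; apply: (@branching_orbit _ _ _ [:: false]).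
  by rewrite /orbit /= subr0.
have px' : p < q * x'.
  apply: unbranched_gap => //; rewrite /x' mulrA.
  have h1 : q * q * (p - 1) - 1 = c * (1 - (q ^+ 2 - q - 1) * q ^+ 2).
    by rewrite pE /c; field; rewrite gt_eqF.
  have h2 : 0 < c * (1 - (q ^+ 2 - q - 1) * q ^+ 2).
    by rewrite mulr_gt0 // subr_gt0; have := lt_q3; nra.
  have h3 : q * q * (p - 1) < q * q * (q * x - 1).
    by rewrite ltr_pM2l ?mulr_gt0 // ltrD2r.
  lra.
split=> //; rewrite ltNge; apply/negP => hle.
have := unbranched_gap hle nb'; rewrite -/x'.
have : x' < q * (q - 1) by rewrite /x' ltr_pM2l // ltrD2r gtr_pMr.
have : q * (q - 1) <= p.
  by rewrite -(ler_pM2r qB1_gt0) /p mulVf ?gt_eqF //; nra.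
by lra.
Qed.

Lemma unbranched_weight y : 0 <= y -> y <= gate 0 -> ~ branching q y ->
  gate_weight ((q ^+ 2 - 1) * y).
Proof.
move=> y0 yA nb; have /andP[hq hq'] := q_bounds.
move: y0; rewrite le_eqVlt => /predU1P[<-|y0]; first by left; rewrite mulr0.
have [m [m0 lt1 ltp nbm]] := small_unbranched_orbit y0 yA nb.
set x := q ^+ m * y in lt1 ltp nbm.
(* [z] is the [k]-th iterate of the loop, written around its fixed point [c q]. Deviations grow by
   the factor [q^2] but the window is bounded, so [x] is the fixed point. *)
have inv k : let z := c * q + (q ^+ 2) ^+ k * (x - c * q) in
    [/\ z < 1, p < q * z & ~ branching q z].
  elim: k => [|k [h1 h2 h3]]; first by rewrite /= mul1r addrC subrK.
  have := golden_loop h1 h2 h3.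
  rewrite [q * (q * _ - 1)](_ : _ = c * q + (q ^+ 2) ^+ k.+1 * (x - c * q)) //.
  have e : c * q * q ^+ 2 - q = c * q.
    have : q = c * (q ^+ 2 - 1) * q by rewrite cE mul1r.
    by lra.
  apply: (@etrans _ _ ((c * q * q ^+ 2 - q) + (q ^+ 2) ^+ k.+1 * (x - c * q))).
    by rewrite [_ ^+ k.+1]exprS; ring.
  by rewrite e.
have xc : x = c * q.
  apply/eqP; rewrite -subr_eq0; apply: contraT => ne.
  have q2gt1 : 1 < q ^+ 2 by nra.
  have nz : 0 < `|x - c * q| by rewrite normr_gt0.
  have [k hk] := exprn_gt1_unbounded (`|x - c * q|^-1) q2gt1.
  have [h1 h2 _] := inv k.
  have zb : `|(q ^+ 2) ^+ k * (x - c * q)| <= 1.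
    set z := _ * (x - _) in h1 h2 *.
    have cq : 0 < c * q < 1.
      by rewrite mulr_gt0 //= /c mulrC ltr_pdivrMr //; have := golden_lt; lra.
    have z0 : 0 < c * q + z by rewrite -(pmulr_rgt0 _ q_gt0) (lt_trans p_gt0).
    by rewrite ler_norml; case/andP: cq => *; apply/andP; split; lra.
  move: zb; rewrite normrM normrX (@ger0_norm _ (q ^+ 2)) ?sqr_ge0 //.
  by rewrite leNgt -ltr_pdivrMr // div1r hk.
have yE : (q ^+ 2 - 1) * y * q ^+ m.-1 = 1.
  have : (q ^+ 2 - 1) * x = q by rewrite xc mulrA [_ * c]mulrC cE mul1r.
  have -> : x = q * (y * q ^+ m.-1) by rewrite /x -{1}(prednK m0) exprS; ring.
  by move=> h; apply: (mulfI q_neq0); rewrite mulr1 -[RHS]h; ring.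
right; exists m.-1 => //.
(* [m = 1] would give the weight 1, too large for [y <= gate 0]. *)
case: m m0 yE {lt1 ltp nbm inv xc} @x => [|[|m]] // _ h.
move: h; rewrite mulr1 => h.
move: yA; rewrite /gate subr0 ler_pdivlMr // mulrC h.
by have := golden_lt; lra.
Qed.

Lemma base_integral_step x (b : bool) : base_integral x -> base_integral (q * x - b%:R).
Proof.
pose lin P (b : bool) : {poly int} := 'X * P - (b%:R)%:P.
have hlin P b' : (map_poly intr (lin P b')).[q] = q * (map_poly intr P).[q] - b'%:R.
  by rewrite rmorphB rmorphM /= map_polyX map_polyC /= !hornerE rmorph_nat.
move=> [[P eP]|[P eP]]; [left; exists (lin P b) | right; exists (lin P (~~ b))].
  by rewrite hlin eP.
rewrite hlin eP mulrBr.
by have := base_fixpoint q1; rewrite -/p; case: (b) => /= h; lra.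
Qed.

Lemma base_integral_orbit x w : base_integral x -> base_integral (orbit q x w).
Proof. by elim: w x => //= b w IHw x /(base_integral_step b)/IHw. Qed.

Lemma base_integral_reflect x : base_integral x -> base_integral (p - x).
Proof. by move=> [h|h]; [right; rewrite subKr | left]. Qed.

Let gateE w : gate w = c * (1 - (q ^+ 2 - q - 1) - w).
Proof. by rewrite /gate mulrC. Qed.

(** That is, [p = gate 0 + 1]: the children [s] and [s + 1] of a fork satisfy [0 <= s <= gate 0]. *)
Let baseBE : p = c * (1 - (q ^+ 2 - q - 1)) + 1.
Proof. by have := cE; rewrite pE; lra. Qed.

Lemma fork_in_base r (b : bool) : 0 <= r <= 1 - (q ^+ 2 - q - 1) ->
  in_base q (c * r + (~~ b)%:R).
Proof.
move=> /andP[r0 rA]; rewrite /in_base -/p.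
have h0 : 0 <= c * r by rewrite mulr_ge0 // ltW.
have hp : c * r <= c * (1 - (q ^+ 2 - q - 1)) by rewrite ler_pM2l.
by rewrite baseBE; case: b => /=; apply/andP; split; lra.
Qed.

Let gate_orbit w r b m : q ^+ m.+1 * gate w - 1 = r / (q ^+ 2 - 1) ->
  orbit q (gate w) (rcons (nseq m false) b) = c * r + (~~ b)%:R.
Proof.
move=> h; rewrite orbit_rcons orbit_nseq_false mulrA -exprS.
by rewrite [c * r]mulrC -h; case: b => /=; ring.
Qed.

Lemma gate_step_branching w r : gate_step w r -> branching q (gate w).
Proof.
move=> [[m hm] hr]; exists (nseq m false) => b.
by rewrite (gate_orbit b hm) fork_in_base.
Qed.

(** The smaller the gate, the more digits 0 precede the fork: one for the weights 0 and [q^-n] with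
    [n >= 3], two for [q^-2], three for [q^-1]. *)
Lemma gate_step_0 : gate_step 0 (1 - q ^+ 2 * (q ^+ 2 - q - 1)).
Proof.
have /andP[hq hq'] := q_bounds; have he := golden_lt; have hl := lt_q3.
split; first by exists 1%N; rewrite /gate; field; rewrite gt_eqF.
by apply/andP; split; nra.
Qed.

Lemma gate_step_ge3 w n : (2 < n)%N -> w * q ^+ n = 1 ->
  gate_step w (1 - q ^+ 2 * (q ^+ 2 - q - 1) - q ^+ 2 * w).
Proof.
move=> hn hw.
have /andP[hq hq'] := q_bounds; have he := golden_lt; have hl := lt_q3.
split; first by exists 1%N; rewrite /gate; field; rewrite gt_eqF.
have w0 : 0 < w by rewrite -(pmulr_lgt0 _ (exprn_gt0 n q_gt0)) hw.
have w3 : w * q ^+ 3 <= 1.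
  by rewrite -hw ler_pM2l // ler_weXn2l // ltW.
have : w * q ^+ 2 * q <= 1 by rewrite -mulrA -exprSr.
have w2 : 0 < w * q ^+ 2 by rewrite mulr_gt0 ?exprn_gt0.
rewrite [q ^+ 2 * w]mulrC; move: w2; set z := w * q ^+ 2 => z0 hz.
have hzq : z * q < 1 + q - q ^+ 2 * (q ^+ 2 - q - 1) * q - 1 + 1 by lra.
apply/andP; split; last by nra.
have : 0 <= (1 - q ^+ 2 * (q ^+ 2 - q - 1) - z) * q by lra.
by rewrite pmulr_lge0.
Qed.

Lemma gate_step_2 w : w * q ^+ 2 = 1 ->
  gate_step w (1 - (q ^+ 2 - q - 1) * (q * (q ^+ 2 - 1))).
Proof.
move=> hw.
have /andP[hq hq'] := q_bounds; have he := golden_lt; have hl := lt_q3.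
have -> : w = (q ^+ 2)^-1 by apply: (mulIf (expf_neq0 2 q_neq0)); rewrite hw mulVf ?expf_neq0.
split; first by exists 2%N; rewrite /gate; field; rewrite q_neq0 gt_eqF.
apply/andP; split; last first.
  by rewrite lerD2l lerN2 ler_peMr ?ltW //; nra.
rewrite subr_ge0; apply: le_trans (_ : (q - 1) * 14%:R / 10%:R <= _); last by lra.
have : (q ^+ 2 - q - 1) * (q * (q ^+ 2 - 1)) <= (q ^+ 2 - q - 1) * q ^+ 3.
  by rewrite ler_pM2l //; nra.
by lra.
Qed.

Lemma gate_step_1 w : w * q ^+ 1 = 1 ->
  gate_step w (1 - (q ^+ 2 - q - 1) * (q ^+ 2 * (q ^+ 2 - 1))).
Proof.
move=> hw.
have /andP[hq hq'] := q_bounds; have he := golden_lt; have hl := lt_q3.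
have -> : w = q^-1 by apply: (mulIf q_neq0); rewrite -[in LHS](expr1 q) hw mulVf.
split; first by exists 3%N; rewrite /gate; field; rewrite q_neq0 gt_eqF.
apply/andP; split; last first.
  by rewrite lerD2l lerN2 ler_peMr ?ltW //; nra.
rewrite subr_ge0 -(ler_pM2l q_gt0) mulr1.
have -> : q * ((q ^+ 2 - q - 1) * (q ^+ 2 * (q ^+ 2 - 1))) =
  q ^+ 3 * (q ^+ 2 - q - 1) * (q ^+ 2 - 1) by ring.
apply: le_trans (_ : (q - 1) * (q ^+ 2 - 1) <= _); last by nra.
by rewrite ler_pM2r // ltW.
Qed.

Lemma gate_weight_step w : gate_weight w -> exists r, gate_step w r.
Proof.
move=> [->|[[|[|[|n]]] // _ hw]]; eexists.
- exact: gate_step_0.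
- exact: gate_step_1.
- exact: gate_step_2.
- exact: gate_step_ge3 hw.
Qed.

Lemma gate_branching w : gate_weight w -> branching q (gate w).
Proof. by move=> /gate_weight_step[r /gate_step_branching]. Qed.

(* Each of the two children of a fork is [gate _] up to reflection, and one of
   them has a single expansion, which determines the weight of the other. *)
Lemma thin_fork y w r : thin q y -> base_integral y ->
  0 <= r <= 1 - (q ^+ 2 - q - 1) ->
  (forall b, orbit q y (rcons w b) = c * r + (~~ b)%:R) ->
  state r \/ state (1 - (q ^+ 2 - q - 1) - r).
Proof.
move=> thy inty hr hw; set e := q ^+ 2 - q - 1 in hr *.
have c1 : c * r = gate (1 - e - r) by rewrite gateE -/e; ring.
have c0 : c * r + 1 = p - gate r by rewrite gateE baseBE -/e; ring.
have int1 : base_integral (c * r).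
  by have := base_integral_orbit (rcons w true) inty; rewrite hw addr0.
have int0 : base_integral (gate r).
  have := base_integral_orbit (rcons w false) inty.
  by rewrite hw c0 => /base_integral_reflect; rewrite subKr.
have weight s : 0 <= s <= 1 - e -> ~ branching q (c * s) -> gate_weight s.
  move=> /andP[s0 sA] nb.
  have -> : s = (q ^+ 2 - 1) * (c * s) by rewrite mulrA [_ * c]mulrC cE mul1r.
  apply: unbranched_weight => //; first by rewrite mulr_ge0 // ltW.
  by rewrite gateE subr0 ler_pM2l.
have [b1|nb1] := pselect (branching q (c * r)).
- have nb0 : ~ branching q (c * r + 1).
    move=> b0; case: thy => _ /(_ w); apply => b; rewrite hw.
    by case: b => /=; rewrite ?addr0.
  right; split; last by rewrite -c1.
  + apply: weight; first by case/andP: hr => *; apply/andP; split; lra.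
    move=> /(branching_reflect q1); apply: contra_not nb0.
    by rewrite -/p baseBE -/e; congr branching; ring.
  + have := @thin_orbit _ _ y (rcons w true) thy; rewrite hw addr0 -c1; exact.
(* Thinness alone does not make the other child branch; it does because every gate with a
   [gate_weight] branches. *)
- have wr : gate_weight r by apply: weight.
  left; split=> //; have bg := gate_branching wr.
  have := @thin_orbit _ _ y (rcons w false) thy; rewrite hw c0.
  move=> /(_ (branching_reflect q1 bg))/(thin_reflect q1).
  by rewrite -/p subKr.
Qed.

Lemma state_step w r : state w -> gate_step w r ->
  state r \/ state (1 - (q ^+ 2 - q - 1) - r).
Proof.
move=> [_ thw intw] [[m hm] hr].
by apply: thin_fork thw intw hr _ => b; apply: gate_orbit hm.
Qed.

Lemma thin_state y : thin q y -> base_integral y -> exists w, state w.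
Proof.
move=> thy inty; have [[w hw] _] := thy.
set s := orbit q y (rcons w true).
have s0 : orbit q y (rcons w false) = s + 1.
  by rewrite /s !orbit_rcons subr0 subrK.
have sE : s = c * ((q ^+ 2 - 1) * s) by rewrite mulrA cE mul1r.
have /andP[s_ge0 _] := hw true; have := hw false; rewrite -/s in s_ge0 *.
rewrite s0 /in_base -/p baseBE => /andP[_]; rewrite lerD2r => sA.
case: (@thin_fork y w ((q ^+ 2 - 1) * s)) => //.
- rewrite mulr_ge0 ?(ltW q2B1_gt0) //=.
  by rewrite -(ler_pM2l c_gt0) -sE.
- by case; rewrite -sE /= ?addr0.
- by eexists; eassumption.
- by eexists; eassumption.
Qed.

End Gates.

(** * Sextics irreducible modulo 2 *)

Section IrreducibleMod2.

Local Notation pZtoQ := (map_poly (intr : int -> rat)).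

Definition odd_int (z : int) : bool := odd `|z|%N.

Let odd_intD x y : odd_int (x + y) = odd_int x (+) odd_int y.
Proof. by rewrite /odd_int; lia. Qed.

Let odd_intM x y : odd_int (x * y) = odd_int x && odd_int y.
Proof. by rewrite /odd_int abszM oddM. Qed.

Let odd_int_sum n (F : 'I_n -> int) :
  odd_int (\sum_(i < n) F i) = \big[addb/false]_(i < n) odd_int (F i).
Proof. by elim/big_rec2: _ => // i b z _ <-; rewrite odd_intD. Qed.

(* Modulo 2, neither [X^6 + X^4 + X^3 + X + 1] nor [X^6 + X^3 + 1] has a factor of
   degree 1, 2 or 3. *)
Lemma small_factor_trivial (f g h : {poly int}) :
  f \is monic -> size f = 7%N ->
  [/\ odd_int f`_0, ~~ odd_int f`_2, odd_int f`_3 & ~~ odd_int f`_5] ->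
  odd_int f`_1 = odd_int f`_4 ->
  f = g * h -> (size g <= 4)%N -> (size g <= 1)%N.
Proof.
move=> monf szf [f0 f2 f3 f5] f14 fgh szg.
have f_neq0 : f != 0 by rewrite -size_poly_eq0 szf.
have : g * h != 0 by rewrite -fgh.
rewrite mulf_eq0 negb_or => /andP[g_neq0 h_neq0].
have szh : (size h <= 7)%N.
  have := size_mul g_neq0 h_neq0; rewrite -fgh szf.
  move: g_neq0; rewrite -size_poly_gt0; move: (size _) (size _) => m n; lia.
have lead_odd : odd_int (lead_coef g).
  have : odd_int (lead_coef g * lead_coef h) by rewrite -lead_coefM -fgh (monicP monf).
  by rewrite odd_intM => /andP[].
have g0 i : (4 <= i)%N -> g`_i = 0 by move=> hi; apply: nth_default; apply: leq_trans hi.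
have h0 i : (7 <= i)%N -> h`_i = 0 by move=> hi; apply: nth_default; apply: leq_trans hi.
have f_coef i : odd_int f`_i = \big[addb/false]_(j < i.+1) (odd_int g`_j && odd_int h`_(i - j)).
  by rewrite fgh coefM odd_int_sum; apply: eq_bigr => j _; rewrite odd_intM.
have f7 i : (7 <= i)%N -> odd_int f`_i = false by move=> hi; rewrite nth_default ?szf.
have f6 : odd_int f`_6 by have := monicP monf; rewrite lead_coefE szf /= => ->.
(* Comparing parities in [f = g h] up to degree 9 = 3 + 6 involves twelve unknown parities; all
   cases are checked. *)
have key : [&& ~~ odd_int g`_1, ~~ odd_int g`_2 & ~~ odd_int g`_3].
  have := f_coef 0%N; have := f_coef 1%N; have := f_coef 2%N; have := f_coef 3%N.
  have := f_coef 4%N; have := f_coef 5%N; have := f_coef 6%N; have := f_coef 7%N.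
  have := f_coef 8%N; have := f_coef 9%N.
  rewrite !big_ord_recl !big_ord0 /= /bump /= !subSS !subn0.
  rewrite !(g0 4, g0 5, g0 6, g0 7, g0 8, g0 9) // !(h0 7, h0 8, h0 9) //.
  rewrite !(f7 7%N, f7 8%N, f7 9%N) // f0 (negbTE f2) f3 (negbTE f5) f6 -f14.
  have -> : odd_int 0 = false by [].
  move: (odd_int g`_0) (odd_int g`_1) (odd_int g`_2) (odd_int g`_3)
    (odd_int h`_0) (odd_int h`_1) (odd_int h`_2)
    (odd_int h`_3) (odd_int h`_4) (odd_int h`_5) (odd_int h`_6) (odd_int f`_1).
  by do 12! case=> //=.
move: key lead_odd szg; rewrite lead_coefE => /and3P[/negbTE k1 /negbTE k2 /negbTE k3].
by case: (size g) => [|[|[|[|[|n]]]]] //=; rewrite ?k1 ?k2 ?k3.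
Qed.

(** The rational gcd has the root [q], so it comes from a nonconstant integral factor of [f], whose
    cofactor is constant by [small_factor_trivial]. Since [f] is monic, divisibility descends to the
    integers. *)
Lemma common_root_dvd (R : realType) (q : R) (f F : {poly int}) :
  f \is monic -> size f = 7%N ->
  [/\ odd_int f`_0, ~~ odd_int f`_2, odd_int f`_3 & ~~ odd_int f`_5] ->
  odd_int f`_1 = odd_int f`_4 ->
  root (map_poly intr f) q -> root (map_poly intr F) q -> exists G, F = f * G.
Proof.
move=> monf szf f_odd f_odd' fq Fq.
have toR (P : {poly int}) : map_poly ratr (pZtoQ P) = map_poly intr P :> {poly R}.
  by rewrite -map_poly_comp; apply: eq_map_poly => z /=; rewrite ratr_int.
have dvdQ : pZtoQ f %| pZtoQ F.
  set d := gcdp (pZtoQ f) (pZtoQ F).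
  have dq : root (map_poly ratr d) q by rewrite gcdp_map root_gcd !toR fq.
  have [p1 [a a0 da] [r fE]] := dvdpP_rat_int (dvdp_gcdl (pZtoQ f) (pZtoQ F)).
  have p1q : root (map_poly intr p1) q.
    move: dq; rewrite /d da map_polyZ /= rootZ ?toR //.
    by rewrite fmorph_eq0.
  have p1_neq0 : p1 != 0.
    by apply: contraTneq monf => p0; rewrite fE p0 mul0r monicE lead_coef0 eq_sym oner_eq0.
  have r_neq0 : r != 0.
    by apply: contraTneq monf => r0; rewrite fE r0 mulr0 monicE lead_coef0 eq_sym oner_eq0.
  have p1_size : (1 < size p1)%N.
    rewrite -(size_map_inj_poly (@intr_inj R)) //.
    apply: root_size_gt1 p1q; rewrite -size_poly_eq0 size_map_inj_poly ?size_poly_eq0 //.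
    exact: intr_inj.
  have szfpr := size_mul p1_neq0 r_neq0; rewrite -fE szf in szfpr.
  have szr : (size r <= 1)%N.
    have [h|h] := leqP (size p1) 4.
      by have := small_factor_trivial monf szf f_odd f_odd' fE h; rewrite leqNgt p1_size.
    apply: (small_factor_trivial monf szf f_odd f_odd' (h := p1)); first by rewrite mulrC.
    by move: szfpr h; move: (size _) (size _) => m n; lia.
  rewrite /d in da; apply: dvdp_trans (dvdp_gcdr (pZtoQ f) (pZtoQ F)).
  rewrite da dvdpZr // fE (size1_polyC szr) rmorphM /= map_polyC /= mulrC mul_polyC.
  rewrite dvdpZl ?dvdpp //.
  by rewrite intr_eq0; apply: contraNneq r_neq0 => h; rewrite (size1_polyC szr) h.
have : f %| F by rewrite -dvdp_rat_int dvdQ.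
by move=> /(Pdiv.IdomainMonic.dvdpP monf)[G ->]; exists G; rewrite mulrC.
Qed.

End IrreducibleMod2.

(** * Arithmetic exclusion of two exceptional values of [q] *)

Section IntegralStates.
Variables (R : realType) (q : R).
Hypothesis q1 : 1 < q.

Let q_gt0 : 0 < q. Proof. exact: lt_trans ltr01 q1. Qed.
Let q2B1_neq0 : q ^+ 2 - 1 != 0.
Proof. by rewrite gt_eqF // subr_gt0 expr2; have := q1; nra. Qed.

(* A state of weight [q^-n] that is an integral polynomial in [q], up to
   reflection, makes [q^2 - 1] divide a unit of Z[q]: evaluate at [X = 1]. *)
Lemma integral_gate_relation w : gate_weight q w -> w <> 0 ->
  base_integral q (gate q w) ->
  exists2 F : {poly int}, root (map_poly intr F) q & F.[1] = -1.
Proof.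
move=> [//|[n _ hw]] _; rewrite /base_integral /gate.
have qn0 : q ^+ n != 0 by rewrite expf_neq0 ?gt_eqF.
have wE : w = (q ^+ n)^-1 by apply: (mulIf qn0); rewrite hw mulVf.
have qB1 : q - 1 != 0 by rewrite subr_eq0 gt_eqF.
case=> [[P eP]|[P eP]].
(* Denominators are cleared in [gate w] with [w = q^-n]; at 1 the multiple of [X^2 - 1] vanishes. *)
- exists ('X^n * ('X^2 - 1) * P - 'X^n * (1 + 1 + 'X - 'X^2) + 1).
    apply/eqP; rewrite !(rmorphD, rmorphN, rmorphM, rmorph1, rmorphXn) /= !map_polyX.
    rewrite !hornerE eP wE; by field; rewrite ?q2B1_neq0 ?qn0 ?qB1.
  by rewrite !hornerE ?expr1n; ring.
- exists ('X^n * ('X^2 - 1) * P - 'X^n * ('X^2 - 1) - 1).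
    apply/eqP; rewrite !(rmorphD, rmorphN, rmorphM, rmorph1, rmorphXn) /= !map_polyX.
    rewrite !hornerE eP wE; by field; rewrite ?q2B1_neq0 ?qn0 ?qB1.
  by rewrite !hornerE ?expr1n; ring.
Qed.

(** If [q] is a root of [f], then [f] divides the relation of [integral_gate_relation], so [f(1)]
    divides -1. *)
Let no_integral_gate (s : 6.-tuple int) w :
  let f : {poly int} := Poly (rcons s 1) in
  [/\ odd_int s`_0, ~~ odd_int s`_2, odd_int s`_3 & ~~ odd_int s`_5] ->
  odd_int s`_1 = odd_int s`_4 -> (1 < absz f.[1])%N ->
  state q w -> w <> 0 -> \sum_(i < 6) (s`_i)%:~R * q ^+ i + q ^+ 6 <> 0.
Proof.
move=> f s_odd s_odd' f1 [wq _ wint] w0 fq.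
have fs : f = rcons s 1 :> seq int by rewrite /f (PolyK (c := 1)) // last_rcons.
have szf : size f = 7%N by rewrite fs size_rcons size_tuple.
have monf : f \is monic by rewrite monicE lead_coefE szf /= fs nth_rcons size_tuple.
have fi i : (i < 6)%N -> f`_i = s`_i by move=> hi; rewrite fs nth_rcons size_tuple hi.
have [F Fq F1] := integral_gate_relation wq w0 wint.
have froot : root (map_poly intr f) q.
  apply/eqP; rewrite horner_coef size_map_inj_poly ?szf //; last exact: intr_inj.
  rewrite big_ord_recr /= coef_map /= fs nth_rcons size_tuple ltnn eqxx mul1r.
  by rewrite -[RHS]fq; congr (_ + _); apply: eq_bigr => i _; rewrite coef_map /= fi.
have [] := @common_root_dvd _ q f F monf szf _ _ froot Fq; rewrite ?fi // => G FE.
move: F1 f1; rewrite FE hornerM; move: (f.[1]) (G.[1]) => a b ab.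
have : (`|a| * `|b| = 1)%N by rewrite -abszM ab.
by move/eqP; rewrite muln_eq1 => /andP[/eqP-> _].
Qed.

(** At a root the right move from [q^-3] returns to [q^-3]. The value at 1 is -5. *)
Lemma state_not_q1 w : state q w -> w <> 0 ->
  q ^+ 6 - q ^+ 4 - q ^+ 3 - 2%:R * q ^+ 2 - q - 1 <> 0.
Proof.
move=> sw w0 hq;
apply: (@no_integral_gate [tuple -1; -1; -2; -1; -1; 0] w _ _ _ sw w0) => //.
  by rewrite horner_Poly.
by rewrite !big_ord_recl big_ord0 /= /bump /= -[RHS]hq; ring.
Qed.

(** At a root the right move from [q^-1] returns to [q^-1]. The value at 1 is -3. *)
Lemma state_not_q2 w : state q w -> w <> 0 ->
  q ^+ 6 - 2%:R * q ^+ 4 - q ^+ 3 - 1 <> 0.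
Proof.
move=> sw w0 hq.
apply: (@no_integral_gate [tuple -1; 0; 0; -1; -2; 0] w _ _ _ sw w0) => //.
  by rewrite horner_Poly.
by rewrite !big_ord_recl big_ord0 /= /bump /= -[RHS]hq; ring.
Qed.

End IntegralStates.

(** * Polynomial estimates on short intervals *)

Lemma shifted (R : realFieldType) (lo hi : R) (P : R -> Prop) :
  (forall t, 0 <= t -> t <= hi - lo -> P (lo + t)) -> forall q, lo <= q <= hi -> P q.
Proof.
move=> h q /andP[h1 h2]; rewrite -(subrKC lo q).
by apply: h; rewrite ?subr_ge0 // lerD2r.
Qed.

Lemma expr_chain (R : realFieldType) (t h : R) k :
  0 <= t -> t <= h -> 0 <= t ^+ k.+1 <= h * t ^+ k.
Proof.
by move=> t0 th; rewrite exprn_ge0 //= exprS ler_wpM2r ?exprn_ge0.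
Qed.

(* Polynomial inequalities on a short interval [lo, hi]: expanding at [lo], the
   powers of [t = q - lo] satisfy [0 <= t^(k+1) <= (hi - lo) t^k], which is
   linear information. *)
Ltac chain_up_to k t0 th :=
  match k with
  | O => idtac
  | S ?k' => have /andP[? ?] := expr_chain k t0 th; chain_up_to k' t0 th
  end.
Tactic Notation "shift_lra" constr(k) :=
  let t := fresh "t" in let t0 := fresh "t0" in let th := fresh "th" in
  apply: shifted; intros t t0 th; chain_up_to k t0 th; lra.

(* The right move replaces the weight [w] by the [r] of [gate_step w r], the left move
   by [1 - (q^2 - q - 1) - r]. In [leftk_n_*] the left move from the weight [q^-k] (0 if
   [k = 0]) hits [q^-n], for one value of [q] only, which lies between the bounds of
   [_lo] and [_hi]; by [_up] and [_dn] the weight after a further move then lies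
   strictly between two consecutive powers of [q]. Likewise for [right2_1_*]; in
   [leftk_ge5_*] the left move hits some [q^-n] with [n >= 5]. *)
Section Estimates.
Variable R : realFieldType.
Implicit Types q : R.

Lemma left0_small q : 55%:R / 34%:R <= q <= 79%:R / 47%:R ->
  (q ^+ 2 - q - 1) * (q ^+ 2 - 1) * q ^+ 2 < 1.
Proof. move: q; shift_lra 5%N. Qed.

Lemma right2_large q : 55%:R / 34%:R <= q <= 79%:R / 47%:R ->
  1 < (1 - (q ^+ 2 - q - 1) * (q * (q ^+ 2 - 1))) * q ^+ 2.
Proof. move: q; shift_lra 6%N. Qed.

Lemma left2_small q : 55%:R / 34%:R <= q <= 79%:R / 47%:R ->
  (q ^+ 2 - q - 1) * (q ^+ 3 - q - 1) * q ^+ 2 < 1.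
Proof. move: q; shift_lra 6%N. Qed.

Lemma left2_gap q : 55%:R / 34%:R <= q <= 79%:R / 47%:R ->
  q ^+ 2 - 1 < (q ^+ 3 - q ^+ 2) * (q ^+ 3 - q - 1).
Proof. move: q; shift_lra 5%N. Qed.

Lemma right1_large q : 55%:R / 34%:R <= q <= 79%:R / 47%:R ->
  1 < (1 - (q ^+ 2 - q - 1) * (q ^+ 2 * (q ^+ 2 - 1))) * q ^+ 3.
Proof. move: q; shift_lra 8%N. Qed.

Lemma left1_gap q : 55%:R / 34%:R <= q <= 79%:R / 47%:R ->
  q ^+ 2 - 1 < (q ^+ 3 - q ^+ 2) * (q ^+ 4 - q ^+ 2 - 1).
Proof. move: q; shift_lra 6%N. Qed.

Lemma left0_3_lo q : 55%:R / 34%:R <= q <= 152%:R / 91%:R ->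
  (q ^+ 2 - q - 1) * (q ^+ 2 - 1) * q ^+ 3 < 1.
Proof. move: q; shift_lra 6%N. Qed.

Lemma left0_3_hi q : 127%:R / 76%:R <= q <= 79%:R / 47%:R ->
  1 < (q ^+ 2 - q - 1) * (q ^+ 2 - 1) * q ^+ 3.
Proof. move: q; shift_lra 6%N. Qed.

Lemma left0_3_up q : 152%:R / 91%:R <= q <= 127%:R / 76%:R ->
  (1 - q ^+ 4 * (q ^+ 2 - q - 1)) * q ^+ 5 < 1.
Proof. move: q; shift_lra 10%N. Qed.

Lemma left0_3_dn q : 152%:R / 91%:R <= q <= 127%:R / 76%:R ->
  1 < (1 - q ^+ 4 * (q ^+ 2 - q - 1)) * q ^+ 6.
Proof. move: q; shift_lra 11%N. Qed.

Lemma left0_4_lo q : 55%:R / 34%:R <= q <= 28%:R / 17%:R ->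
  (q ^+ 2 - q - 1) * (q ^+ 2 - 1) * q ^+ 4 < 1.
Proof. move: q; shift_lra 7%N. Qed.

Lemma left0_4_hi q : 43%:R / 26%:R <= q <= 79%:R / 47%:R ->
  1 < (q ^+ 2 - q - 1) * (q ^+ 2 - 1) * q ^+ 4.
Proof. move: q; shift_lra 7%N. Qed.

Lemma left0_4_up q : 28%:R / 17%:R <= q <= 43%:R / 26%:R ->
  (1 - q ^+ 4 * (q ^+ 2 - q - 1)) * q ^+ 1 < 1.
Proof. move: q; shift_lra 6%N. Qed.

Lemma left0_4_dn q : 28%:R / 17%:R <= q <= 43%:R / 26%:R ->
  1 < (1 - q ^+ 4 * (q ^+ 2 - q - 1)) * q ^+ 2.
Proof. move: q; shift_lra 7%N. Qed.

Lemma left0_ge5_hi q : 64%:R / 39%:R <= q <= 79%:R / 47%:R ->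
  1 < (q ^+ 2 - q - 1) * (q ^+ 2 - 1) * q ^+ 5.
Proof. move: q; shift_lra 8%N. Qed.

Lemma left0_ge5_dn q : 55%:R / 34%:R <= q <= 64%:R / 39%:R ->
  1 < (1 - q ^+ 4 * (q ^+ 2 - q - 1)) * q.
Proof. move: q; shift_lra 6%N. Qed.

Lemma right2_1_lo q : 55%:R / 34%:R <= q <= 62%:R / 37%:R ->
  (q ^+ 2 - q - 1) * q ^+ 2 * (q + 1) < 1.
Proof. move: q; shift_lra 4%N. Qed.

Lemma right2_1_hi q : 47%:R / 28%:R <= q <= 79%:R / 47%:R ->
  1 < (q ^+ 2 - q - 1) * q ^+ 2 * (q + 1).
Proof. move: q; shift_lra 4%N. Qed.

Lemma right2_1_up q : 62%:R / 37%:R <= q <= 47%:R / 28%:R ->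
  (1 - (q ^+ 2 - q - 1) * (q ^+ 2 * (q ^+ 2 - 1))) * q ^+ 2 < 1.
Proof. move: q; shift_lra 7%N. Qed.

Lemma right2_1_dn q : 62%:R / 37%:R <= q <= 47%:R / 28%:R ->
  1 < (1 - (q ^+ 2 - q - 1) * (q ^+ 2 * (q ^+ 2 - 1))) * q ^+ 3.
Proof. move: q; shift_lra 8%N. Qed.

Lemma right2_1_left_up q : 62%:R / 37%:R <= q <= 47%:R / 28%:R ->
  ((q ^+ 2 - q - 1) * (q ^+ 4 - q ^+ 2 - 1)) * q ^+ 1 < 1.
Proof. move: q; shift_lra 6%N. Qed.

Lemma right2_1_left_dn q : 62%:R / 37%:R <= q <= 47%:R / 28%:R ->
  1 < ((q ^+ 2 - q - 1) * (q ^+ 4 - q ^+ 2 - 1)) * q ^+ 2.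
Proof. move: q; shift_lra 7%N. Qed.

Lemma left2_3_lo q : 55%:R / 34%:R <= q <= 368%:R / 221%:R ->
  (q ^+ 2 - q - 1) * (q ^+ 3 - q - 1) * q ^+ 3 < 1.
Proof. move: q; shift_lra 7%N. Qed.

Lemma left2_3_hi q : 5%:R / 3%:R <= q <= 79%:R / 47%:R ->
  1 < (q ^+ 2 - q - 1) * (q ^+ 3 - q - 1) * q ^+ 3.
Proof. move: q; shift_lra 7%N. Qed.

Lemma left2_3_up q : 368%:R / 221%:R <= q <= 5%:R / 3%:R ->
  (1 - q ^+ 3 * (q ^+ 2 - q - 1) * (q ^+ 2 - 1)) * q ^+ 4 < 1.
Proof. move: q; shift_lra 10%N. Qed.

Lemma left2_3_dn q : 368%:R / 221%:R <= q <= 5%:R / 3%:R ->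
  1 < (1 - q ^+ 3 * (q ^+ 2 - q - 1) * (q ^+ 2 - 1)) * q ^+ 5.
Proof. move: q; shift_lra 11%N. Qed.

Lemma left2_4_lo q : 55%:R / 34%:R <= q <= 28%:R / 17%:R ->
  (q ^+ 2 - q - 1) * (q ^+ 3 - q - 1) * q ^+ 4 < 1.
Proof. move: q; shift_lra 8%N. Qed.

Lemma left2_4_hi q : 38%:R / 23%:R <= q <= 79%:R / 47%:R ->
  1 < (q ^+ 2 - q - 1) * (q ^+ 3 - q - 1) * q ^+ 4.
Proof. move: q; shift_lra 8%N. Qed.

Lemma left2_4_up q : 28%:R / 17%:R <= q <= 38%:R / 23%:R ->
  (1 - q ^+ 3 * (q ^+ 2 - q - 1) * (q ^+ 2 - 1)) * q ^+ 1 < 1.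
Proof. move: q; shift_lra 7%N. Qed.

Lemma left2_4_dn q : 28%:R / 17%:R <= q <= 38%:R / 23%:R ->
  1 < (1 - q ^+ 3 * (q ^+ 2 - q - 1) * (q ^+ 2 - 1)) * q ^+ 2.
Proof. move: q; shift_lra 8%N. Qed.

Lemma left2_ge5_hi q : 41%:R / 25%:R <= q <= 79%:R / 47%:R ->
  1 < (q ^+ 2 - q - 1) * (q ^+ 3 - q - 1) * q ^+ 5.
Proof. move: q; shift_lra 9%N. Qed.

Lemma left2_ge5_dn q : 55%:R / 34%:R <= q <= 41%:R / 25%:R ->
  1 < (1 - q ^+ 3 * (q ^+ 2 - q - 1) * (q ^+ 2 - 1)) * q.
Proof. move: q; shift_lra 7%N. Qed.

Lemma left1_4_lo q : 55%:R / 34%:R <= q <= 67%:R / 41%:R ->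
  (q ^+ 2 - q - 1) * (q ^+ 4 - q ^+ 2 - 1) * q ^+ 4 < 1.
Proof. move: q; shift_lra 9%N. Qed.

Lemma left1_4_hi q : 18%:R / 11%:R <= q <= 79%:R / 47%:R ->
  1 < (q ^+ 2 - q - 1) * (q ^+ 4 - q ^+ 2 - 1) * q ^+ 4.
Proof. move: q; shift_lra 9%N. Qed.

Lemma left1_4_up q : 67%:R / 41%:R <= q <= 18%:R / 11%:R ->
  (1 - q ^+ 4 * (q ^+ 2 - q - 1) * (q ^+ 2 - 1)) * q ^+ 1 < 1.
Proof. move: q; shift_lra 8%N. Qed.

Lemma left1_4_dn q : 67%:R / 41%:R <= q <= 18%:R / 11%:R ->
  1 < (1 - q ^+ 4 * (q ^+ 2 - q - 1) * (q ^+ 2 - 1)) * q ^+ 2.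
Proof. move: q; shift_lra 9%N. Qed.

Lemma left1_ge5_hi q : 31%:R / 19%:R <= q <= 79%:R / 47%:R ->
  1 < (q ^+ 2 - q - 1) * (q ^+ 4 - q ^+ 2 - 1) * q ^+ 5.
Proof. move: q; shift_lra 10%N. Qed.

Lemma left1_ge5_dn q : 55%:R / 34%:R <= q <= 31%:R / 19%:R ->
  1 < (1 - q ^+ 4 * (q ^+ 2 - q - 1) * (q ^+ 2 - 1)) * q.
Proof. move: q; shift_lra 8%N. Qed.

End Estimates.

(** * Locating weights between powers of [q] *)

Section Weights.
Variables (R : realType) (q : R).
Hypothesis q1 : 1 < q.
Implicit Types w l r : R.

Let q_gt0 : 0 < q. Proof. exact: lt_trans ltr01 q1. Qed.

Lemma weight_below r a : gate_weight q r -> 1 < r * q ^+ a ->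
  exists2 n, (0 < n < a)%N & r * q ^+ n = 1.
Proof.
move=> [->|[n n0 hn]] h; first by move: h; rewrite mul0r ltr10.
have r0 : 0 < r by rewrite -(pmulr_lgt0 _ (exprn_gt0 n q_gt0)) hn.
by exists n => //; rewrite n0 /= -(ltr_eXn2l q1) -(ltr_pM2l r0) hn.
Qed.

Lemma weight_above r a : gate_weight q r -> r <> 0 -> r * q ^+ a < 1 ->
  exists2 n, (a < n)%N & r * q ^+ n = 1.
Proof.
move=> [->|[n n0 hn]] // _ h.
have r0 : 0 < r by rewrite -(pmulr_lgt0 _ (exprn_gt0 n q_gt0)) hn.
by exists n => //; rewrite -(ltr_eXn2l q1) -(ltr_pM2l r0) hn.
Qed.

Lemma weight_gap r a : gate_weight q r -> r * q ^+ a < 1 -> 1 < r * q ^+ a.+1 -> False.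
Proof.
move=> wr h1 h2; have r0 : r <> 0 by move=> r0; move: h2; rewrite r0 mul0r ltr10.
have [n hn en] := weight_above wr r0 h1.
have [n' /andP[_ hn'] en'] := weight_below wr h2.
move: h2; rewrite ltNge -en; apply/negP/negPn.
rewrite ler_pM2l ?ler_weXn2l ?(ltW q1) //.
by rewrite -(pmulr_lgt0 _ (exprn_gt0 n q_gt0)) en.
Qed.

Lemma weight_lt1 r : gate_weight q r -> 1 < r * q -> False.
Proof. by rewrite -{2}[q]expr1 => wr /(weight_below wr)[[]]. Qed.

(** The bounds on [l] are the consecutive powers [q^-(n-2)] and [q^-(n-3)]. *)
Lemma weight_scaled_gap w l n : (2 < n)%N -> w * q ^+ n = 1 ->
  q ^+ 2 * w < l -> l < q ^+ 3 * w -> gate_weight q l -> False.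
Proof.
case: n => [|[|[|n]]] // _ hw h2 h3 wl; apply: (weight_gap (a := n) wl).
  apply: lt_le_trans (_ : q ^+ 3 * w * q ^+ n <= _).
    by rewrite ltr_pM2r ?exprn_gt0.
  by rewrite mulrAC -exprD mulrC addnC addn3 hw.
apply: le_lt_trans (_ : _ <= q ^+ 2 * w * q ^+ n.+1) _.
  by rewrite mulrAC -exprD mulrC addnC addn2 hw.
by rewrite ltr_pM2r ?exprn_gt0.
Qed.

Lemma weight_le w n m : (m <= n)%N -> w * q ^+ n = 1 -> w * q ^+ m <= 1.
Proof.
move=> lemn hw; rewrite -hw ler_pM2l ?ler_weXn2l ?(ltW q1) //.
by rewrite -(pmulr_lgt0 _ (exprn_gt0 n q_gt0)) hw.
Qed.

End Weights.

(** * No weight carries a state below [q3] *)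

Section DeadStates.
Variables (R : realType) (q : R).
Hypothesis q1 : 1 < q.
Hypothesis golden_lt : 0 < q ^+ 2 - q - 1.
Hypothesis lt_q3 : q ^+ 3 * (q ^+ 2 - q - 1) < q - 1.

Let q_gt0 : 0 < q. Proof. exact: lt_trans ltr01 q1. Qed.
Let lo_q : 55%:R / 34%:R <= q.
Proof. by have /andP[/ltW] := q_bounds q1 golden_lt lt_q3. Qed.
Let q_hi : q <= 79%:R / 47%:R.
Proof. by have /andP[_ /ltW] := q_bounds q1 golden_lt lt_q3. Qed.
Let q_range : 55%:R / 34%:R <= q <= 79%:R / 47%:R.
Proof. by rewrite lo_q. Qed.
Let step w r := state_step q1 golden_lt lt_q3 (w := w) (r := r).

Local Notation e := (q ^+ 2 - q - 1).

Let state_weight w : state q w -> gate_weight q w. Proof. by case. Qed.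

Let below (hi : R) (g : R -> R) :
  (forall x, hi <= x <= 79%:R / 47%:R -> 1 < g x) -> g q <= 1 -> q <= hi.
Proof.
move=> h gq; rewrite leNgt; apply/negP => /ltW hq.
by have := h q; rewrite hq q_hi => /(_ isT); rewrite ltNge gq.
Qed.

Let above (lo : R) (g : R -> R) :
  (forall x, 55%:R / 34%:R <= x <= lo -> g x < 1) -> 1 <= g q -> lo <= q.
Proof.
move=> h gq; rewrite leNgt; apply/negP => /ltW hq.
by have := h q; rewrite hq lo_q => /(_ isT); rewrite ltNge gq.
Qed.

(** The right move exceeds [1/q]. If the left move hits [q^-n], then [n >= 3]; for [n = 3, 4] this
    pins [q] to a short interval where the next right move misses all weights, and for [n >= 5] that
    move exceeds [1/q]. The next left move lies between [q^2 w] and [q^3 w]. *)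
Lemma no_state_0 : ~ state q 0.
Proof.
move=> s0; have [sr|] := step s0 (gate_step_0 q1 golden_lt lt_q3).
  by apply: (weight_lt1 q1 (state_weight sr)); have := lt_q3; lra.
rewrite (_ : _ - _ = e * (q ^+ 2 - 1)); last by ring.
set w := e * _ => sw.
have w0 : 0 < w by rewrite mulr_gt0 //; have := q1; nra.
have wne0 : w <> 0 by move=> w_eq; move: w0; rewrite w_eq ltxx.
have [n hn en] := weight_above q1 (state_weight sw) wne0 (left0_small q_range).
have [sr|sl] := step sw (gate_step_ge3 q1 golden_lt lt_q3 hn en).
  have rE : 1 - q ^+ 2 * e - q ^+ 2 * w = 1 - q ^+ 4 * e by rewrite /w; ring.
  rewrite {}rE in sr; have wr := state_weight sr.
  case: n => [|[|[|[|[|n]]]]] // in hn en *.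
  - have h1 : q <= 127%:R / 76%:R by apply: (below (@left0_3_hi R)); rewrite -/w en.
    have h2 : 152%:R / 91%:R <= q by apply: (above (@left0_3_lo R)); rewrite -/w en.
    by apply: (weight_gap q1 wr (left0_3_up _) (left0_3_dn _)); rewrite h2.
  - have h1 : q <= 43%:R / 26%:R by apply: (below (@left0_4_hi R)); rewrite -/w en.
    have h2 : 28%:R / 17%:R <= q by apply: (above (@left0_4_lo R)); rewrite -/w en.
    by apply: (weight_gap q1 wr (left0_4_up _) (left0_4_dn _)); rewrite h2.
  - have h1 : q <= 64%:R / 39%:R.
      by apply: (below (@left0_ge5_hi R)); rewrite -/w (weight_le q1 _ en).
    by apply: (weight_lt1 q1 wr (left0_ge5_dn _)); rewrite lo_q.
apply: (weight_scaled_gap q1 hn en _ _ (state_weight sl)).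
  by rewrite -subr_gt0 [X in 0 < X](_ : _ = w) // /w; ring.
rewrite -subr_gt0 [X in 0 < X](_ : _ = w * (q ^+ 3 - q ^+ 2 - 1)); last by rewrite /w; ring.
by rewrite mulr_gt0 //; have := lo_q; nra.
Qed.

(** The right move can only hit [1/q], which pins [q] so closely that both moves from [1/q] miss all
    weights. The left move fails as in [no_state_0]. *)
Lemma no_state_2 w : w * q ^+ 2 = 1 -> ~ state q w.
Proof.
move=> ew sw; have [] := step sw (gate_step_2 q1 golden_lt lt_q3 ew).
  set r := 1 - _ => sr; have := right2_large q_range; rewrite -/r => hr.
  have [n /andP[n0 n2] en] := weight_below q1 (state_weight sr) hr.
  have {n n0 n2}en : r * q ^+ 1 = 1 by case: n n0 n2 en => [|[|]].
  have g : e * q ^+ 2 * (q + 1) = 1.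
    have : (e * q ^+ 2 * (q + 1) - 1) * (q - 1) = 0.
      by move: en; rewrite /r expr1 => en; lra.
    by move/eqP; rewrite mulf_eq0 [q - 1 == 0]subr_eq0 [q == 1]gt_eqF // orbF subr_eq0 => /eqP.
  have h1 : q <= 47%:R / 28%:R by apply: (below (@right2_1_hi R)); rewrite g.
  have h2 : 62%:R / 37%:R <= q by apply: (above (@right2_1_lo R)); rewrite g.
  have [sr'|sl'] := step sr (gate_step_1 q1 golden_lt lt_q3 en).
    by apply: (weight_gap q1 (state_weight sr') (right2_1_up _) (right2_1_dn _)); rewrite h2.
  apply: (weight_gap q1 (r := e * (q ^+ 4 - q ^+ 2 - 1)) _
    (right2_1_left_up _) (right2_1_left_dn _));
    rewrite ?h2 //.
  by move: sl' => /state_weight; congr gate_weight; ring.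
rewrite (_ : _ - _ = e * (q ^+ 3 - q - 1)); last by ring.
set l := e * _ => sl.
have g0 : 0 < q ^+ 3 - q - 1 by have := lo_q; nra.
have l0 : 0 < l by rewrite mulr_gt0.
have lne0 : l <> 0 by move=> l_eq; move: l0; rewrite l_eq ltxx.
have [n hn en] := weight_above q1 (state_weight sl) lne0 (left2_small q_range).
have [sr|sl'] := step sl (gate_step_ge3 q1 golden_lt lt_q3 hn en).
  have rE : 1 - q ^+ 2 * e - q ^+ 2 * l = 1 - q ^+ 3 * e * (q ^+ 2 - 1) by rewrite /l; ring.
  rewrite {}rE in sr; have wr := state_weight sr.
  case: n => [|[|[|[|[|n]]]]] // in hn en *.
  - have h1 : q <= 5%:R / 3%:R by apply: (below (@left2_3_hi R)); rewrite -/l en.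
    have h2 : 368%:R / 221%:R <= q by apply: (above (@left2_3_lo R)); rewrite -/l en.
    by apply: (weight_gap q1 wr (left2_3_up _) (left2_3_dn _)); rewrite h2.
  - have h1 : q <= 38%:R / 23%:R by apply: (below (@left2_4_hi R)); rewrite -/l en.
    have h2 : 28%:R / 17%:R <= q by apply: (above (@left2_4_lo R)); rewrite -/l en.
    by apply: (weight_gap q1 wr (left2_4_up _) (left2_4_dn _)); rewrite h2.
  - have h1 : q <= 41%:R / 25%:R.
      by apply: (below (@left2_ge5_hi R)); rewrite -/l (weight_le q1 _ en).
    by apply: (weight_lt1 q1 wr (left2_ge5_dn _)); rewrite lo_q.
apply: (weight_scaled_gap q1 hn en _ _ (state_weight sl')).
  rewrite -subr_gt0 [X in 0 < X](_ : _ = e * (q ^+ 2 - 1)); last by ring.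
  by rewrite mulr_gt0 //; have := q1; nra.
rewrite -subr_gt0 [X in 0 < X](_ : _ =
  e * ((q ^+ 3 - q ^+ 2) * (q ^+ 3 - q - 1) - (q ^+ 2 - 1))); last by rewrite /l; ring.
by rewrite mulr_gt0 // subr_gt0 left2_gap.
Qed.

Lemma no_state_1 w : w * q ^+ 1 = 1 -> ~ state q w.
Proof.
move=> ew sw; have [] := step sw (gate_step_1 q1 golden_lt lt_q3 ew).
  set r := 1 - _ => sr; have := right1_large q_range; rewrite -/r => hr.
  have [n /andP[n0 n3] en] := weight_below q1 (state_weight sr) hr.
  case: n n0 n3 en => [|[|[|]]] // _ _ en; last exact: no_state_2 en sr.
  have rne0 : r <> 0 by move=> r_eq; move: hr; rewrite r_eq mul0r ltr10.
  (* This right move from [1/q] to itself could be repeated forever, so arithmetic replaces the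
     estimates. *)
  apply: (state_not_q2 q1 sr rne0).
  have : (q ^+ 6 - 2%:R * q ^+ 4 - q ^+ 3 - 1) * (q - 1) = 0.
    by move: en; rewrite /r expr1 => en; lra.
  by move/eqP; rewrite mulf_eq0 [q - 1 == 0]subr_eq0 [q == 1]gt_eqF // orbF => /eqP.
rewrite (_ : _ - _ = e * (q ^+ 4 - q ^+ 2 - 1)); last by ring.
set l := e * _ => sl.
have g0 : 0 < q ^+ 4 - q ^+ 2 - 1.
  rewrite [X in 0 < X](_ : _ = (q ^+ 2 - 2%:R) * (q ^+ 2 + 1) + 1); last by ring.
  have h2 : 2%:R < q ^+ 2 by have := lo_q; nra.
  by rewrite addr_gt0 // mulr_gt0 ?subr_gt0 // addr_gt0 ?exprn_gt0.
have l0 : 0 < l by rewrite mulr_gt0.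
have lne0 : l <> 0 by move=> l_eq; move: l0; rewrite l_eq ltxx.
have l1 : l * q ^+ 1 < 1.
  rewrite -subr_gt0 [X in 0 < X](_ : _ =
    (q - 1 - q ^+ 3 * e) * (q ^+ 2 - 1)); last by rewrite /l; ring.
  by rewrite mulr_gt0 ?subr_gt0 //; have := q1; nra.
have [n hn en] := weight_above q1 (state_weight sl) lne0 l1.
case: (ltnP 2 n) => n2; last first.
  by have en2 : l * q ^+ 2 = 1; [case: n hn n2 en => [|[|[|]]] | exact: no_state_2 en2 sl].
case: (eqVneq n 3%N) => [n3|n3].
  (* At this [q] the right move from [q^-3] returns to [q^-3], so arithmetic is needed again. *)
  apply: (state_not_q1 q1 sl lne0); move: en; rewrite {}n3 => en.
  have : (q ^+ 6 - q ^+ 4 - q ^+ 3 - 2%:R * q ^+ 2 - q - 1) * ((q - 1) ^+ 2 * (q + 1)) = 0.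
    by move: en; rewrite /l => en; lra.
  move/eqP; rewrite mulf_eq0 => /orP[/eqP //|].
  by rewrite gt_eqF // mulr_gt0 ?exprn_gt0 ?subr_gt0 ?addr_gt0.
have [sr|sl'] := step sl (gate_step_ge3 q1 golden_lt lt_q3 n2 en).
  have rE : 1 - q ^+ 2 * e - q ^+ 2 * l = 1 - q ^+ 4 * e * (q ^+ 2 - 1) by rewrite /l; ring.
  rewrite {}rE in sr; have wr := state_weight sr.
  case: n => [|[|[|[|[|n]]]]] // in hn n2 n3 en *.
  - have h1 : q <= 18%:R / 11%:R by apply: (below (@left1_4_hi R)); rewrite -/l en.
    have h2 : 67%:R / 41%:R <= q by apply: (above (@left1_4_lo R)); rewrite -/l en.
    by apply: (weight_gap q1 wr (left1_4_up _) (left1_4_dn _)); rewrite h2.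
  - have h1 : q <= 31%:R / 19%:R.
      by apply: (below (@left1_ge5_hi R)); rewrite -/l (weight_le q1 _ en).
    by apply: (weight_lt1 q1 wr (left1_ge5_dn _)); rewrite lo_q.
apply: (weight_scaled_gap q1 n2 en _ _ (state_weight sl')).
  rewrite -subr_gt0 [X in 0 < X](_ : _ = e * (q ^+ 2 - 1)); last by ring.
  by rewrite mulr_gt0 //; have := q1; nra.
rewrite -subr_gt0 [X in 0 < X](_ : _ =
  e * ((q ^+ 3 - q ^+ 2) * (q ^+ 4 - q ^+ 2 - 1) - (q ^+ 2 - 1))); last by rewrite /l; ring.
by rewrite mulr_gt0 // subr_gt0 left1_gap.
Qed.

Lemma no_state_gt_expr3 w : 1 < w * q ^+ 3 -> ~ state q w.
Proof.
move=> h sw; have [n /andP[n0 n3] en] := weight_below q1 (state_weight sw) h.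
by case: n n0 n3 en => [|[|[|]]] // _ _ en; [exact: no_state_1 en sw | exact: no_state_2 en sw].
Qed.

(** By [lt_q3] and the bound on [w] the product exceeds [q^2 - q], which is above 1. *)
Let step_right_large w : w * q ^+ 4 <= 1 ->
  1 < (1 - q ^+ 2 * e - q ^+ 2 * w) * q ^+ 3.
Proof.
move=> hw; have h1 := ler_wpM2l (ltW q_gt0) hw.
have h2 : q ^+ 2 * (q ^+ 3 * e) < q ^+ 2 * (q - 1) by rewrite ltr_pM2l ?exprn_gt0.
have := golden_lt; lra.
Qed.

(** Left moves lower the exponent, and for [n >= 4] the right move exceeds [q^-3]. From [q^-3] the
    right move may return, which arithmetic excludes, or reach [q^-i] with [i >= 4], from which both
    moves exceed [q^-3]. *)
Lemma no_state_ge3 n w : (2 < n)%N -> w * q ^+ n = 1 -> ~ state q w.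
Proof.
elim/ltn_ind: n w => n IHn w hn ew sw.
have w0 : 0 < w by rewrite -(pmulr_lgt0 _ (exprn_gt0 n q_gt0)) ew.
have E0 : 0 < e * (q ^+ 2 - 1) by rewrite mulr_gt0 //; have := q1; nra.
have left_dead : forall l, q ^+ 2 * w < l -> ~ state q l.
  move=> l hl sl.
  have h : 1 < l * q ^+ (n - 2).
    apply: le_lt_trans (_ : _ <= q ^+ 2 * w * q ^+ (n - 2)) _.
      by rewrite mulrAC -exprD mulrC subnKC ?ew // ltnW.
    by rewrite ltr_pM2r ?exprn_gt0.
  have [i /andP[i0 hi] ei] := weight_below q1 (state_weight sl) h.
  have [i2|i2] := ltnP 2 i.
    by apply: (IHn i _ l i2 ei sl); apply: leq_trans hi (leq_subr _ _).
  by case: i i0 i2 ei {hi} => [|[|[|]]] // _ _ ei;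
      [exact: no_state_1 ei sl | exact: no_state_2 ei sl].
have [sr|sl] := step sw (gate_step_ge3 q1 golden_lt lt_q3 hn ew); last first.
  apply: (left_dead _ _ sl).
  by rewrite -subr_gt0 [X in 0 < X](_ : _ = e * (q ^+ 2 - 1)) //; ring.
have [n4|n4] := ltnP 3 n.
  by apply: (no_state_gt_expr3 (step_right_large (weight_le q1 n4 ew)) sr).
have {n4 IHn left_dead}n_eq : n = 3%N by apply/eqP; rewrite eqn_leq n4 hn.
move: ew sr; rewrite {n hn}n_eq => ew; set r := 1 - _ - _ => sr.
have rq : r * q = q - 1 - q ^+ 3 * e.
  rewrite /r; have : w * q ^+ 3 = 1 := ew; lra.
have r0 : 0 < r by rewrite -(pmulr_lgt0 _ q_gt0) rq subr_gt0.
have [r_eq|[i i0 ei]] := state_weight sr; first by move: r0; rewrite r_eq ltxx.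
case: (ltnP i 3) => i3.
  by case: i i0 i3 ei => [|[|[|]]] // _ _ ei; [exact: no_state_1 ei sr | exact: no_state_2 ei sr].
case: (eqVneq i 3%N) => [i_eq|ine3].
  rewrite {}i_eq in ei.
  have rne0 : r <> 0 by move=> r_eq; move: r0; rewrite r_eq ltxx.
  apply: (state_not_q1 q1 sr rne0).
  have : (q ^+ 6 - q ^+ 4 - q ^+ 3 - 2%:R * q ^+ 2 - q - 1) * (q - 1) = 0.
    have h : r * q * q ^+ 2 = 1 by rewrite -ei; ring.
    by move: h; rewrite rq; lra.
  by move/eqP; rewrite mulf_eq0 [q - 1 == 0]subr_eq0 [q == 1]gt_eqF // orbF => /eqP.
have i4 : (4 <= i)%N by rewrite ltn_neqAle eq_sym ine3.
have [sr'|sl'] := step sr (gate_step_ge3 q1 golden_lt lt_q3 i3 ei).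
  exact: (no_state_gt_expr3 (step_right_large (weight_le q1 i4 ei)) sr').
apply: (no_state_gt_expr3 _ sl').
(* The left move from [r] gives the same weight as the right move from [1/q]. *)
have -> : 1 - e - (1 - q ^+ 2 * e - q ^+ 2 * r) =
   1 - (q ^+ 2 - q - 1) * (q ^+ 2 * (q ^+ 2 - 1)).
  by have -> : q ^+ 2 * r = q * (r * q); [ring | rewrite rq; ring].
exact: right1_large.
Qed.

Lemma no_state w : ~ state q w.
Proof.
move=> sw; have [w0|[[|[|[|n]]] // _ hw]] := state_weight sw.
- by move: sw; rewrite w0; apply: no_state_0.
- exact: no_state_1 hw sw.
- exact: no_state_2 hw sw.
- exact: no_state_ge3 hw sw.
Qed.

End DeadStates.

(** * Contradiction below [q3] *)

Section BelowQ3.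
Variables (R : realType) (q : R).
Hypothesis q1 : 1 < q.
Hypothesis golden_lt : 0 < q ^+ 2 - q - 1.
Hypothesis lt_q3 : q ^+ 3 * (q ^+ 2 - q - 1) < q - 1.

Lemma not_countably_infinite : ~ (qexpansions q 1 #= [set: nat])%card.
Proof.
rewrite card_eq_sym qexpansionsE // => /card_set_bijP[f [ff finj fsurj]].
have f_exp n : expansion q 1 (f n) by apply: ff.
have b1 : branching q 1.
  apply: (two_expansions_branching (f_exp 0%N) (f_exp 1%N)) => f01.
  by have := finj 0%N 1%N; rewrite !inE => /(_ I I f01).
have [d hd|v thv] := countable_thin q1 (e := f) b1.
  by have [n _ <-] := fsurj d hd; exists n.
have int1 : base_integral q 1 by left; exists 1; rewrite rmorph1 hornerC.
have [w sw] := thin_state q1 golden_lt lt_q3 thv (base_integral_orbit q1 v int1).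
exact: (no_state q1 golden_lt lt_q3 sw).
Qed.

End BelowQ3.

(** * The expansions of 1 at [q3] *)

Section AtQ3.
Variables (R : realType) (q : R).
Hypothesis q1 : 1 < q.
Hypothesis q2 : q < 2%:R.
Hypothesis q3E : q ^+ 3 * (q ^+ 2 - q - 1) = q - 1.

Let p : R := (q - 1)^-1.
Let c : R := (q ^+ 2 - 1)^-1.
Local Notation e := (q ^+ 2 - q - 1).

Let q_gt0 : 0 < q. Proof. exact: lt_trans ltr01 q1. Qed.
Let e_gt0 : 0 < e.
Proof. by rewrite -(pmulr_rgt0 _ (exprn_gt0 3 q_gt0)) q3E subr_gt0. Qed.
Let q2B1_gt0 : 0 < q ^+ 2 - 1. Proof. by have := e_gt0; have := q1; lra. Qed.
Let c_gt0 : 0 < c. Proof. by rewrite invr_gt0. Qed.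
Let cE : c * (q ^+ 2 - 1) = 1. Proof. by rewrite mulVf // gt_eqF. Qed.
Let pE : p = c * (q + 1).
Proof. by rewrite /p /c; field; rewrite !gt_eqF // subr_gt0. Qed.

Lemma orbit_mkseq x (d : nat -> bool) v :
  v 0%N = x -> (forall n, v n.+1 = q * v n - (d n)%:R) ->
  forall n, orbit q x (mkseq d n) = v n.
Proof.
by move=> v0 vS; elim=> [|n IHn]; rewrite ?mkseqS ?orbit_rcons ?IHn ?vS // -v0.
Qed.

(** The digits 00(10)^oo of [c / q]; from place 1 on its orbit alternates between [c] and [q c]. *)
Let loop_digit n := (0 < n)%N && ~~ odd n.
Let loop_value n : R := if n is n'.+1 then if odd n' then q * c else c else c / q.

Let loop_orbit n : orbit q (c / q) (mkseq loop_digit n) = loop_value n.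
Proof.
apply: orbit_mkseq => // -[|[|k]] /=.
- by field; rewrite gt_eqF.
- by rewrite subr0.
rewrite /loop_digit /= negbK; case: (odd k) => /=; first by rewrite subr0.
by have := cE; lra.
Qed.

Let loop_value_bound n : 0 < loop_value n < p.
Proof.
have cq : 0 < c / q by rewrite divr_gt0.
have cq' : c / q < c by rewrite ltr_pdivrMr // ltr_pMr.
have qc : 0 < c * q by rewrite mulr_gt0.
have := c_gt0; case: n => [|n]; rewrite /= ?pE; first by move=> c0; apply/andP; split; lra.
by move=> c0; case: odd; apply/andP; split; lra.
Qed.

Let loop_not_branching : ~ branching q (c / q).
Proof.
apply: (not_branching_spine q1 (d0 := loop_digit)) => n.
rewrite orbit_rcons loop_orbit /in_base -/p.
have qc : q * c < 1 by rewrite ltr_pdivrMr // mul1r; have := e_gt0; lra.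
have cq : c < 1.
  by rewrite invf_lt1 //; have := e_gt0; have := q1; lra.
case: n => [|n] /=.
  by rewrite mulrC divfK ?gt_eqF // subr_ge0 leNgt cq.
rewrite /loop_digit /=; case: (odd n) => /=.
  rewrite subr0 -/p [_ <= p]leNgt negb_and negbK pE; apply/orP; right.
  have : 0 < c * e by rewrite mulr_gt0.
  by lra.
by rewrite subr_ge0 [1 <= _]leNgt qc.
Qed.

(** Multiplied by [q (q^2 - 1)], this is the equation of [q3]. *)
Let branch_point : q * (q - 1) = p - c / q.
Proof.
rewrite pE; apply: (mulfI (x := q * (q ^+ 2 - 1))).
  by rewrite mulf_neq0 // gt_eqF.
have -> : q * (q ^+ 2 - 1) * (c * (q + 1) - c / q) =
  (c * (q ^+ 2 - 1)) * (q * (q + 1) - 1) by field; rewrite gt_eqF.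
by rewrite cE mul1r; have := q3E; lra.
Qed.

Let branch_expansion : expansion q (q * (q - 1)) (fun n => ~~ loop_digit n).
Proof.
move=> n; have -> : mkseq (fun n => ~~ loop_digit n) n = map negb (mkseq loop_digit n).
  by rewrite /mkseq -map_comp.
rewrite branch_point orbit_reflect // in_base_reflect loop_orbit /in_base -/p.
by have /andP[h1 h2] := loop_value_bound n; rewrite !ltW.
Qed.

(** The digits 1(1000)^oo. Place 0 has the value 1; entry 0 of the list serves the positive
    multiples of 4. *)
Let spine_digit n := (n == 0)%N || (n %% 4 == 1)%N.
Let spine_value n : R :=
  if n is 0%N then 1 else nth 0 [:: q ^+ 2 * e; q - 1; e; q * e] (n %% 4).

Let spine_orbit n : orbit q 1 (mkseq spine_digit n) = spine_value n.
Proof.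
apply: orbit_mkseq => // -[|k]; first by rewrite /= mulr1.
rewrite /spine_value /spine_digit -[k.+2]addn1 -modnDml /=.
have : (k.+1 %% 4 < 4)%N by rewrite ltn_mod.
by case: (k.+1 %% 4)%N => [|[|[|[|]]]] //= _; have := q3E; lra.
Qed.

Lemma expansions_at_q3 : (qexpansions q 1 #= [set: nat])%card.
Proof.
rewrite qexpansionsE //; apply: eq_card_nat.
  apply: (spine_countable (d0 := spine_digit)) => n.
  rewrite orbit_rcons spine_orbit; case: n => [|n].
    rewrite /= subr0 mulr1 => /(branching_in_base q1)/andP[_].
    rewrite leNgt => /negP; apply.
    rewrite -/p pE -(ltr_pM2r q2B1_gt0) mulrAC cE mul1r.
    by have := mulr_gt0 q_gt0 e_gt0; have := e_gt0; lra.
  rewrite /spine_value /spine_digit /=.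
  have : (n.+1 %% 4 < 4)%N by rewrite ltn_mod.
  have qe : q ^+ 3 * e < 1 by rewrite q3E; have := q2; lra.
  have e0 := e_gt0.
  (* In residues 0, 2 and 3 the opposite digit 1 makes the orbit negative; in residue 1 the opposite
     digit 0 leads to [branch_point]. *)
  case: (n.+1 %% 4)%N => [|[|[|[|]]]] //= _.
  - by move=> /(branching_in_base q1)/andP[]; rewrite mulrA -exprS subr_ge0 leNgt qe.
  - rewrite subr0 branch_point => /(branching_reflect q1).
    by rewrite -/p subKr; apply: loop_not_branching.
  - move=> /(branching_in_base q1)/andP[]; rewrite subr_ge0 leNgt.
    by rewrite (lt_trans _ qe) // ltr_pM2r // exprS ltr_pMr // exprn_egt1.
  - move=> /(branching_in_base q1)/andP[]; rewrite subr_ge0 leNgt.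
    by rewrite (lt_trans _ qe) // mulrA ltr_pM2r // exprS ltr_pM2l // ltr_pMr.
have mod1 k : ((4 * k).+1 %% 4 = 1)%N by rewrite -addn1 mulnC modnMDl.
(* [f k] leaves the spine at visit number [k], counted from 0, to [q - 1]. *)
pose leave k := rcons (mkseq spine_digit (4 * k + 1)) false.
pose f k i := if (i < size (leave k))%N then nth false (leave k) i
              else ~~ loop_digit (i - size (leave k)).
have f_exp k : expansion q 1 (f k).
  apply: (@expansion_glue _ _ q1 1 (leave k) (fun n => ~~ loop_digit n)).
  rewrite orbit_rcons spine_orbit addn1 /spine_value.
  by rewrite mod1 /= subr0; apply: branch_expansion.
have f_at k : f k (4 * k + 1)%N = false.
  by rewrite /f size_rcons size_mkseq ltnSn nth_rcons size_mkseq ltnn eqxx.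
have f_before k i : (i < 4 * k + 1)%N -> f k i = spine_digit i.
  by move=> hi; rewrite /f size_rcons size_mkseq ltnS (ltnW hi) nth_rcons size_mkseq hi nth_mkseq.
have f_inj k k' : (k < k')%N -> f k <> f k'.
  move=> ltk fk; have := f_at k; rewrite fk f_before; last by rewrite !addn1 ltnS ltn_pmul2l.
  by rewrite /spine_digit addn1 mod1 orbT.
apply/infiniteP; apply: card_le_trans (subset_card_le (_ : f @` [set: nat] `<=` _)).
  suff : (f @` [set: nat] #= [set: nat])%card by rewrite card_eq_le => /andP[].
  apply: inj_card_eq => k k' _ _ fk.
  by case: (ltngtP k k') => // /f_inj; rewrite fk.
by move=> d [k _ <-]; apply: f_exp.
Qed.

End AtQ3.

(** * Location and uniqueness of [q3], and the conclusion *)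

Lemma golden_ratio_lt (R : realType) (q : R) :
  (golden_ratio R < q) = (1 < q) && (0 < q ^+ 2 - q - 1).
Proof.
rewrite /golden_ratio; set s := Num.sqrt _.
have s0 : 0 <= s by apply: sqrtr_ge0.
have s2 : s ^+ 2 = 5%:R by rewrite sqr_sqrtr.
have s_gt2 : 2%:R < s by rewrite ltNge; apply/negP => h; nra.
by apply/idP/andP => [h|[h1 h2]]; [split; nra | nra].
Qed.

(** The factor [x^2 - x - 1] grows by more than [y - x], and multiplication by [x^3 > 1] makes this
    outweigh the growth of [x - 1]. *)
Lemma quintic_increasing (R : realType) (x y : R) :
  1 < x -> 0 < x ^+ 2 - x - 1 -> x < y ->
  x ^+ 3 * (x ^+ 2 - x - 1) - (x - 1) < y ^+ 3 * (y ^+ 2 - y - 1) - (y - 1).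
Proof.
move=> x1 ex xy.
have x3 : 1 < x ^+ 3 by rewrite exprn_egt1.
have xy3 : x ^+ 3 < y ^+ 3 by rewrite ltrXn2r // ?nnegrE; lra.
have exy : x ^+ 2 - x - 1 + (y - x) < y ^+ 2 - y - 1 by nra.
have h1 : x ^+ 3 * (y ^+ 2 - y - 1) < y ^+ 3 * (y ^+ 2 - y - 1).
  by rewrite ltr_pM2r //; lra.
have h2 : x ^+ 3 * (x ^+ 2 - x - 1 + (y - x)) < x ^+ 3 * (y ^+ 2 - y - 1).
  by rewrite ltr_pM2l //; lra.
have h3 : y - x < x ^+ 3 * (y - x) by rewrite ltr_pMl // subr_gt0.
by lra.
Qed.

Lemma q3_rootP (R : realType) (x : R) : q3_root x <->
  1 < x < 2%:R /\ x ^+ 3 * (x ^+ 2 - x - 1) = x - 1.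
Proof. by split=> -[h1 h2]; split=> //; lra. Qed.

Lemma q3_root_golden (R : realType) (x : R) : q3_root x -> golden_ratio R < x.
Proof.
move=> /q3_rootP[/andP[x1 _] h]; rewrite golden_ratio_lt x1 /=.
have x0 : 0 < x by apply: lt_trans ltr01 x1.
by rewrite -(pmulr_rgt0 _ (exprn_gt0 3 x0)) h subr_gt0.
Qed.

Theorem theorem1p1 (R : realType) :
  exists q3 : R,
    [/\ unique (@q3_root R) q3,
        golden_ratio R < q3,
        B1_aleph0 R q3
      & B1_aleph0 R `&` `]golden_ratio R, q3[ = set0].
Proof.
have [q3 q3P] : exists q3 : R, q3_root q3.
  pose f : {poly R} := 'X^5 - 'X^4 - 'X^3 - 'X + 1.
  have fE x : f.[x] = x ^+ 5 - x ^+ 4 - x ^+ 3 - x + 1 by rewrite !hornerE.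
  have [||x /andP[x1 x2] /rootP] := @poly_ivt R f (8%:R / 5%:R) (9%:R / 5%:R).
  - lra.
  - by rewrite !fE; apply/andP; split; lra.
  by rewrite fE => fx; exists x; split=> //; apply/andP; split; lra.
have := q3_root_golden q3P; have /q3_rootP[/andP[q3_gt1 q3_lt2] q3E] := q3P => g3.
have lt3 q : golden_ratio R < q -> q < q3 -> q ^+ 3 * (q ^+ 2 - q - 1) < q - 1.
  rewrite golden_ratio_lt => /andP[q1 eq] qq3.
  by have := quintic_increasing q1 eq qq3; rewrite q3E; lra.
have ge3 q : q3_root q -> ~ q < q3.
  move=> qP qq3; have := lt3 q (q3_root_golden qP) qq3.
  by have /q3_rootP[_ ->] := qP; rewrite ltxx.
exists q3; split=> //.
- split=> // x xP; have /negP := ge3 x xP; rewrite -leNgt le_eqVlt => /orP[/eqP //|].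
  move: xP => /[dup] xg /q3_rootP[_ xE] q3x.
  have := g3; rewrite golden_ratio_lt => /andP[q1 e0].
  by have := quintic_increasing q1 e0 q3x; rewrite q3E xE !subrr ltxx.
- by split; [rewrite (ltW g3) q3_lt2 | apply: expansions_at_q3].
apply/seteqP; split=> // q [[_ qcard]]; rewrite /= in_itv /= => /andP[gq qq3].
have hq := lt3 q gq qq3; move: gq; rewrite golden_ratio_lt => /andP[q1 e0].
exact: (not_countably_infinite q1 e0 hq).
Qed.
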